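(* There exist absolute constants $\alpha,\beta>0$ (not depending on $l,n,\mu_1,\mu_2$) such that the following holds. Let $f=\frac1n\sum_{i=1}^nf_i:\mathbb{R}^{d_1}\times\mathbb{R}^{d_2}\to\mathbb{R}$, where each $f_i$ is continuously differentiable with $l$-Lipschitz gradients, suppose $f$ satisfies the existence-of-saddle-point assumption and the two-sided PL condition with constants $\mu_1,\mu_2>0$, where $\mu_1,\mu_2\le l$, and set $\kappa=l/\min(\mu_1,\mu_2)$. Run VR-AGDA with $$\tau_1=\frac{\beta}{28\kappa^8l},\quad \tau_2=\frac{\beta}{l\kappa^6},\quad N=\Big\lfloor\alpha\beta^{-3/2}\kappa^9\big(2+4\beta^{1/2}\kappa^{-3}\big)^{-1}\Big\rfloor,\quad T=1,$$ and put $P_k=a^k+\frac1{20}b^k$. Then $P_{k+1}\le\frac12P_k$ for all $k$. Consequently, VR-AGDA achieves an $\epsilon$-optimal solution with total complexity $$\mathcal{O}\big((n+\kappa^9)\log(1/\epsilon)\big).$$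
   Context: Norms are Euclidean. Problem: $\min_x\max_y f(x,y)=\frac1n\sum_{i=1}^nf_i(x,y)$. $f_i$ has $l$-Lipschitz gradients: for all $x_1,x_2\in\mathbb{R}^{d_1}$, $y_1,y_2\in\mathbb{R}^{d_2}$, $\|\nabla_x f_i(x_1,y_1)-\nabla_x f_i(x_2,y_2)\|\le l[\|x_1-x_2\|+\|y_1-y_2\|]$ and $\|\nabla_y f_i(x_1,y_1)-\nabla_y f_i(x_2,y_2)\|\le l[\|x_1-x_2\|+\|y_1-y_2\|]$. Existence of saddle point: there is $(x^*,y^* )$ with $f(x^*,y)\le f(x^*,y^* )\le f(x,y^* )$ for all $(x,y)$; moreover for every $y$, $\min_x f(x,y)$ has a nonempty solution set and finite optimal value, and for every $x$, $\max_y f(x,y)$ has a nonempty solution set and finite optimal value. Two-sided PL condition with constants $\mu_1,\mu_2>0$ (imposed on $f$, not on the individual $f_i$): for all $(x,y)$, $\|\nabla_x f(x,y)\|^2\ge 2\mu_1[f(x,y)-\min_{x'}f(x',y)]$ and $\|\nabla_y f(x,y)\|^2\ge 2\mu_2[\max_{y'}f(x,y')-f(x,y)]$. VR-AGDA: input an initial point $(\tilde x_0,\tilde y_0)$, stepsizes $\tau_1,\tau_2$ and iteration numbers $N,T$. For each epoch $k=0,1,2,\dots$: for $t=0,\dots,T-1$, set $x_{t,0}=\tilde x_t$, $y_{t,0}=\tilde y_t$, compute the full gradients $\nabla_xf(\tilde x_t,\tilde y_t)$ and $\nabla_yf(\tilde x_t,\tilde y_t)$; for $j=0,\dots,N-1$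 sample i.i.d. indices $i_j^1,i_j^2$ uniformly from $\{1,\dots,n\}$ (independent of the past) and set $x_{t,j+1}=x_{t,j}-\tau_1[\nabla_xf_{i_j^1}(x_{t,j},y_{t,j})-\nabla_xf_{i_j^1}(\tilde x_t,\tilde y_t)+\nabla_xf(\tilde x_t,\tilde y_t)]$, $y_{t,j+1}=y_{t,j}+\tau_2[\nabla_yf_{i_j^2}(x_{t,j+1},y_{t,j})-\nabla_yf_{i_j^2}(\tilde x_t,\tilde y_t)+\nabla_yf(\tilde x_t,\tilde y_t)]$; then set $\tilde x_{t+1}=x_{t,N}$, $\tilde y_{t+1}=y_{t,N}$. After the loop over $t$, choose $(x^k,y^k)$ uniformly at random from $\{(x_{t,j},y_{t,j}):0\le j\le N-1,\ 0\le t\le T-1\}$ and restart the next epoch with $\tilde x_0=x^k$, $\tilde y_0=y^k$. Notation: $g(x):=\max_yf(x,y)$, $g^*:=\min_xg(x)$, $a^k=\mathbb{E}[g(x^k)-g^*]$, $b^k=\mathbb{E}[g(x^k)-f(x^k,y^k)]$. An $\epsilon$-optimal solution means an output $(x^k,y^k)$ with $P_k\le\epsilon$. Total complexity is the number of evaluations of component gradients $\nabla f_i$ (a full gradient costs $n$); $\mathcal{O}$ hides absolute constants, with the initial potential value treated as a constant inside the logarithm. *)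

(* Defs.v *)
From HB Require Import structures.
From mathcomp Require Import all_boot all_order all_algebra.
From mathcomp Require Import all_classical all_reals all_analysis.

Set Implicit Arguments.
Unset Strict Implicit.
Unset Printing Implicit Defensive.

Import Order.TTheory GRing.Theory Num.Theory.
Import numFieldNormedType.Exports.

Local Open Scope classical_set_scope.
Local Open Scope ring_scope.

(** * Minimax objectives on R^d1 x R^d2 *)

Section Objective.
Context {R : realType} {d1 d2 : nat}.
Implicit Types (F : 'rV[R]_d1 -> 'rV[R]_d2 -> R).

(* The norm that the library puts on 'rV[R]_d is the sup norm. *)
Definition enorm {d : nat} (v : 'rV[R]_d) : R :=
  Num.sqrt (\sum_(j < d) v ord0 j ^+ 2).

Definition grad {d : nat} (h : 'rV[R]_d -> R) (x : 'rV[R]_d) : 'rV[R]_d :=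
  \row_(j < d) 'D_(delta_mx ord0 j) h x.

Definition gradx F x y : 'rV[R]_d1 := grad (F ^~ y) x.
Definition grady F x y : 'rV[R]_d2 := grad (F x) y.

Definition continuously_differentiable F : Prop :=
  (forall z : 'rV[R]_d1 * 'rV[R]_d2,
      differentiable (fun z' : 'rV[R]_d1 * 'rV[R]_d2 => F z'.1 z'.2) z) /\
  continuous (fun z : 'rV[R]_d1 * 'rV[R]_d2 =>
                (gradx F z.1 z.2, grady F z.1 z.2)).

Definition lipschitz_gradients (l : R) F : Prop :=
  forall x1 x2 y1 y2,
    enorm (gradx F x1 y1 - gradx F x2 y2)
      <= l * (enorm (x1 - x2) + enorm (y1 - y2)) /\
    enorm (grady F x1 y1 - grady F x2 y2)
      <= l * (enorm (x1 - x2) + enorm (y1 - y2)).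

Definition has_saddle_point F : Prop :=
  exists xs ys, forall x y, F xs y <= F xs ys /\ F xs ys <= F x ys.

(* Solvability of the two partial problems: the optimal values are attained,
   hence finite. *)
Definition partial_minima_attained F : Prop :=
  forall y, exists x0, forall x, F x0 y <= F x y.

Definition partial_maxima_attained F : Prop :=
  forall x, exists y0, forall y, F x y <= F x y0.

(* In the reals [inf] and [sup] return a default value on sets that are empty
   or unbounded; they are the intended min and max because the optima are
   attained under the standing assumptions. *)
Definition minx F (y : 'rV[R]_d2) : R := inf (range (F ^~ y)).
Definition maxy F (x : 'rV[R]_d1) : R := sup (range (F x)).
Definition minimax F : R := inf (range (maxy F)).

Definition two_sided_PL (mu1 mu2 : R) F : Prop :=
  forall x y,
    2 * mu1 * (F x y - minx F y) <= enorm (gradx F x y) ^+ 2 /\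
    2 * mu2 * (maxy F x - F x y) <= enorm (grady F x y) ^+ 2.

Definition average {n : nat}
    (f : 'I_n -> 'rV[R]_d1 -> 'rV[R]_d2 -> R) x y : R :=
  n%:R^-1 * \sum_(i < n) f i x y.

End Objective.

(** * Families of finite-valued random variables *)

Section Sampling.
Context {R : realType} {d : measure_display} {Omega : measurableType d}.
Variable P : probability Omega R.
Context {I : eqType} {E : I -> finType}.
Variables (D : pred I) (X : forall i, Omega -> E i).

Definition random_variables : Prop :=
  forall i, D i -> forall A : set (E i), measurable (X i @^-1` A).

Definition uniformly_distributed : Prop :=
  forall i, D i -> forall v : E i,
    P (X i @^-1` [set v]) = ((#|E i|%:R)^-1)%:E.

Definition mutually_independent : Prop :=
  forall (s : seq I) (A : forall i, set (E i)),
    uniq s -> {subset s <= D} ->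
    P (\bigcap_(i in [set` s]) (X i @^-1` A i)) =
    (\prod_(i <- s) P (X i @^-1` A i))%E.

End Sampling.

(** * VR-AGDA *)

Section Algorithm.
Context {R : realType} {d1 d2 n : nat}.
Variable f : 'I_n -> 'rV[R]_d1 -> 'rV[R]_d2 -> R.
Variables tau1 tau2 : R.
Local Notation point := ('rV[R]_d1 * 'rV[R]_d2)%type.
Local Notation F := (average f).

(* The y-update uses the new x. *)
Definition vr_step (anchor : point) (i1 i2 : 'I_n) (z : point) : point :=
  let x' := z.1 - tau1 *: (gradx (f i1) z.1 z.2
                           - gradx (f i1) anchor.1 anchor.2
                           + gradx F anchor.1 anchor.2) in
  let y' := z.2 + tau2 *: (grady (f i2) x' z.2
                           - grady (f i2) anchor.1 anchor.2
                           + grady F anchor.1 anchor.2) in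
  (x', y').

(* [inner_iterate anchor i1 i2 j] is (x_{t,j}, y_{t,j}), with i1 and i2 the
   indices sampled during the inner loop number t. *)
Fixpoint inner_iterate (anchor : point) (i1 i2 : nat -> 'I_n) (j : nat)
    : point :=
  if j is j'.+1
  then vr_step anchor (i1 j') (i2 j') (inner_iterate anchor i1 i2 j')
  else anchor.

Variables T N : nat.

(* [anchor_point z i1 i2 t] is (x~_t, y~_t) in an epoch started at z. *)
Fixpoint anchor_point (z : point) (i1 i2 : nat -> nat -> 'I_n) (t : nat)
    : point :=
  if t is t'.+1
  then inner_iterate (anchor_point z i1 i2 t') (i1 t') (i2 t') N
  else z.

Definition epoch_iterate (z : point) (i1 i2 : nat -> nat -> 'I_n)
    (t j : nat) : point :=
  inner_iterate (anchor_point z i1 i2 t) (i1 t) (i2 t) j.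

(* Iterate 0 is the input point and iterate k.+1 is the point selected at the
   end of the (k+1)-st epoch, which starts at iterate k. In epoch k, [i1 k t j]
   and [i2 k t j] are the sampled component indices, and [out k] is the pair
   (t, j) selected for the output. *)
Fixpoint vr_agda {Omega : Type} (z0 : point)
    (i1 i2 : nat -> nat -> nat -> Omega -> 'I_n)
    (out : nat -> Omega -> 'I_T * 'I_N) (k : nat) (w : Omega) : point :=
  if k is k'.+1
  then epoch_iterate (vr_agda z0 i1 i2 out k' w)
         (fun t j => i1 k' t j w) (fun t j => i2 k' t j w)
         (out k' w).1 (out k' w).2
  else z0.

End Algorithm.

(* Component-gradient evaluations in K epochs. Each of the T inner loops of an
   epoch computes two full gradients (n evaluations each) and, at each of its N
   steps, the gradients of two sampled components at two points. *)
Definition vr_agda_cost (n T N K : nat) : nat := K * (T * (2 * n + 4 * N)).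

(** * Randomness of VR-AGDA *)

Section Draws.
Context {R : realType} {d : measure_display} {Omega : measurableType d}.
Variable P : probability Omega R.
Context {n T N : nat}.
Variables (i1 i2 : nat -> nat -> nat -> Omega -> 'I_n).
Variable out : nat -> Omega -> 'I_T * 'I_N.

(* Labels of the random draws: the first (resp. second) index sampled at
   (epoch, t, j), and the output selection of an epoch. *)
Definition draw : Type :=
  (nat * nat * nat) + (nat * nat * nat) + nat.

(* Only the draws with t < T and j < N are performed. *)
Definition performed : pred draw := fun c =>
  match c with
  | inl (inl (_, t, j)) => (t < T) && (j < N)
  | inl (inr (_, t, j)) => (t < T) && (j < N)
  | inr _ => true
  end%N.

Definition draw_range (c : draw) : finType :=
  match c with
  | inl _ => 'I_n
  | inr _ => ('I_T * 'I_N)%type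
  end.

Definition draw_value (c : draw) : Omega -> draw_range c :=
  match c with
  | inl (inl (k, t, j)) => i1 k t j
  | inl (inr (k, t, j)) => i2 k t j
  | inr k => out k
  end.

Definition vr_agda_sampling : Prop :=
  [/\ random_variables performed draw_value,
      uniformly_distributed P performed draw_value
    & mutually_independent P performed draw_value].

End Draws.

(** * Potential *)

Section Potential.
Context {R : realType} {d : measure_display} {Omega : measurableType d}.
Context {d1 d2 : nat}.
Variable P : probability Omega R.
Variable F : 'rV[R]_d1 -> 'rV[R]_d2 -> R.
Variable z : nat -> Omega -> 'rV[R]_d1 * 'rV[R]_d2.

Local Open Scope ereal_scope.

Definition primal_gap (k : nat) : \bar R :=
  'E_P[fun w => (maxy F (z k w).1 - minimax F)%R].

Definition dual_gap (k : nat) : \bar R :=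
  'E_P[fun w => (maxy F (z k w).1 - F (z k w).1 (z k w).2)%R].

Definition potential (k : nat) : \bar R :=
  primal_gap k + (20^-1)%:E * dual_gap k.

End Potential.

(* Main.v *)
Require Import Defs.
From mathcomp Require Import all_boot all_order all_algebra.
From mathcomp Require Import all_classical all_reals all_analysis.
From mathcomp Require Import measurable_realfun ring lra.
Import Order.TTheory GRing.Theory Num.Theory.
Import numFieldNormedType.Exports.
Local Open Scope classical_set_scope.
Local Open Scope ring_scope.

(* Put M(x) = max_y F(x, y).  If y0 maximises F(x, .), the PL condition in y at
   x + v, where the y-gradient at y0 is at most l|v|, shows that M has the
   quadratic upper model with gradient G = grad_x F(x, y0) and curvature
   2 l kappa.  Comparing this model with the lower quadratic model of F(., y)
   gives |G - grad_x F(x, y)|^2 <= 6 l kappa (M(x) - F(x, y)), which replaces the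
   usual quadratic-growth argument.  Hence one inner step decreases, in
   conditional expectation, (M - min M) + (M - F)/20 up to a variance that the
   control variate bounds by the squared distance to the anchor.  Adding that
   squared distance with weight g (2 - j/N) at inner step j absorbs the variance
   and the drift.  Summing over j, the average potential over the inner loop is
   at most half of the initial one.  Expectations are computed by averaging over
   one fresh draw at a time. *)

Set Implicit Arguments.
Unset Strict Implicit.
Unset Printing Implicit Defensive.

(** * Functions of finitely many independent uniform draws *)

Section FiniteSampling.
Context {R : realType} {d : measure_display} {Omega : measurableType d}.
Variable P : probability Omega R.
Context {I : choiceType} {E : I -> finType}.
Variables (D : pred I) (X : forall i, Omega -> E i).

(** A pointwise form of measurability with respect to the draws in [s]. The codomain is any type, so
    points, pairs of points and reals are treated alike. *)
Definition determined {S : Type} (s : seq I) (Y : Omega -> S) : Prop :=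
  forall w w', (forall c, c \in s -> X c w = X c w') -> Y w = Y w'.

Lemma determined_sub {S : Type} (s s' : seq I) (Y : Omega -> S) :
  {subset s <= s'} -> determined s Y -> determined s' Y.
Proof. by move=> ss' dY w w' e; apply: dY => c /ss'; apply: e. Qed.

Lemma determined_comp {S S' : Type} (h : S -> S') s (Y : Omega -> S) :
  determined s Y -> determined s (fun w => h (Y w)).
Proof. by move=> dY w w' e; rewrite (dY w w'). Qed.

Lemma determined_comp2 {S1 S2 S' : Type} (h : S1 -> S2 -> S') s
    (Y1 : Omega -> S1) (Y2 : Omega -> S2) :
  determined s Y1 -> determined s Y2 -> determined s (fun w => h (Y1 w) (Y2 w)).
Proof. by move=> d1 d2 w w' e; rewrite (d1 w w')// (d2 w w'). Qed.

Definition fiber {c : I} (e : E c) : set Omega := X c @^-1` [set e].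

(* [Z e] is a version of [Y] in which the draw [c] is frozen at the value [e]. *)
Lemma determined_split (c : I) (s : seq I) (Y : Omega -> R) :
  determined (c :: s) Y -> (forall w, 0 <= Y w) ->
  exists Z : E c -> Omega -> R,
    [/\ forall e, determined s (Z e), forall e w, 0 <= Z e w
      & forall w, Y w = \sum_e Z e w * \1_(fiber e) w].
Proof.
move=> dY Y0.
pose V e w : set R := [set y | exists w', [/\ X c w' = e,
  forall c', c' \in s -> X c' w' = X c' w & Y w' = y]].
exists (fun e w => xget 0 (V e w)); split.
- move=> e w w' h; congr (xget 0 _); apply/seteqP; split=> y [w1 [h1 h2 h3]];
  exists w1; split=> // c' c's; rewrite h2// h//.
- by move=> e w; case: xgetP => [y _ [w' [_ _ <-]]|].
- move=> w; rewrite (bigD1 (X c w))//= big1 ?addr0; last first.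
    move=> e ne; rewrite indicE memNset ?mulr0// /fiber /= => h.
    by rewrite h eqxx in ne.
  rewrite indicE mem_set// mulr1.
  case: xgetP => [y _ [w' [h1 h2 <-]]|/(_ (Y w)) []].
    apply: dY => c'; rewrite inE => /orP[/eqP->//|/h2//].
  by exists w; split.
Qed.

Hypothesis X_rv : random_variables D X.

Lemma measurable_fiber (c : I) (e : E c) : c \in D -> measurable (fiber e).
Proof. by move=> cD; exact: X_rv. Qed.

(** Induction on [s]: freezing the head draw writes [Y] as a finite sum of measurable functions of
    the tail times indicators of fibers. *)
Lemma measurable_determined (s : seq I) (Y : Omega -> R) :
  {subset s <= D} -> determined s Y -> (forall w, 0 <= Y w) ->
  measurable_fun setT Y.
Proof.
elim: s Y => [|c s IH] Y sD dY Y0.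
  have -> : Y = cst (Y point) by apply/funext => w; apply: dY.
  exact: measurable_cst.
have [Z [dZ Z0 YZ]] := determined_split dY Y0.
rewrite (funext YZ); apply: measurable_sum => e.
apply: measurable_funM.
  by apply: IH => // c' c's; apply: sD; rewrite inE c's orbT.
by apply: measurable_indic; apply: measurable_fiber; apply: sD; rewrite inE eqxx.
Qed.

Definition set_event (A : forall i, set (E i)) (c : I) (e : E c) :
    forall i, set (E i) :=
  @eqtype.dfwith I (fun i => set (E i)) A c [set e].

Definition joint_event (s : seq I) (A : forall i, set (E i)) : set Omega :=
  \bigcap_(i in [set` s]) (X i @^-1` A i).

Lemma joint_event_cons (c : I) (e : E c) s A : c \notin s ->
  joint_event (c :: s) (set_event A e) = fiber e `&` joint_event s A.
Proof.
move=> cs; rewrite /joint_event !bigcap_seq big_cons /set_event dfwith_in; congr (_ `&` _).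
apply: eq_big_seq => i si; rewrite dfwith_out//.
by apply: contraNneq cs => ->.
Qed.

Lemma measurable_joint_event s A : {subset s <= D} -> measurable (joint_event s A).
Proof.
move=> sD; rewrite /joint_event bigcap_seq big_seq.
elim/big_ind : _ => [|B C mB mC|i /sD iD]; [exact: measurableT|exact: measurableI|exact: X_rv].
Qed.

Hypothesis X_indep : mutually_independent P D X.

Lemma probability_joint_event_cons (c : I) (e : E c) s A :
  uniq (c :: s) -> {subset c :: s <= D} ->
  P (fiber e `&` joint_event s A) = (P (fiber e) * P (joint_event s A))%E.
Proof.
move=> /= /[dup] us /andP[cs us'] sD.
rewrite -joint_event_cons// [LHS]X_indep// big_cons /set_event dfwith_in; congr (_ * _)%E.
rewrite [RHS]X_indep//; last by move=> i si; apply: sD; rewrite inE si orbT.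
apply: eq_big_seq => i si; rewrite dfwith_out//.
by apply: contraNneq cs => ->.
Qed.

(** Induction on [s]: the fiber of the head draw passes from [Y] to the event, so [s'] and [A] must
    vary in the induction. *)
Lemma integral_determined_indic (s s' : seq I) (A : forall i, set (E i))
    (Y : Omega -> R) :
  {subset s <= D} -> uniq s' -> {subset s' <= D} ->
  (forall c, c \in s -> c \notin s') ->
  determined s Y -> (forall w, 0 <= Y w) ->
  (\int[P]_w (Y w * \1_(joint_event s' A) w)%:E
   = \int[P]_w (Y w)%:E * P (joint_event s' A))%E.
Proof.
elim: s s' A Y => [|c s IH] s' A Y sD us' s'D ss' dY Y0.
  have {dY} -> : Y = (fun=> Y point) by apply/funext => w; apply: dY.
  have mB := measurable_joint_event A s'D.
  under eq_integral do rewrite EFinM.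
  rewrite ge0_integralZl//; last 2 first.
  - by apply/measurable_EFinP; apply: measurable_indic.
  - by rewrite lee_fin.
  rewrite integral_indic// setIT; congr (_ * _)%E.
  by have := expectation_cst P (Y point); rewrite unlock => ->.
have sD' : {subset s <= D} by move=> c' c's; apply: sD; rewrite inE c's orbT.
have cD : c \in D by apply: sD; rewrite inE eqxx.
(* A draw that recurs in the tail is dropped from the list. *)
have [cs|cs] := boolP (c \in s).
  apply: IH => //; last first.
    by apply: determined_sub dY => c'; rewrite inE => /orP[/eqP->|].
  by move=> c' c's; apply: ss'; rewrite inE c's orbT.
have [Z [dZ Z0 YZ]] := determined_split dY Y0.
have cs' : c \notin s' by apply: ss'; rewrite inE eqxx.
have mZ e : measurable_fun setT (Z e) by apply: (measurable_determined sD').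
have mF (e : E c) := measurable_fiber e cD.
have mB := measurable_joint_event A s'D.
(* The induction hypothesis is applied with the event list [[:: c]] here and with [c :: s'] below;
   the two results then match term by term. *)
have IH1 e : (\int[P]_w (Z e w * \1_(fiber e) w)%:E
    = \int[P]_w (Z e w)%:E * P (fiber e))%E.
  have := IH [:: c] (set_event (fun=> setT) e) (Z e) sD' isT.
  rewrite joint_event_cons// /joint_event bigcap_seq big_nil setIT; apply => //.
  - by move=> c'; rewrite inE => /eqP->.
  - by move=> c' c's; rewrite inE; apply: contraTneq c's => ->.
have IH2 e : (\int[P]_w (Z e w * \1_(fiber e) w * \1_(joint_event s' A) w)%:E
    = \int[P]_w (Z e w)%:E * (P (fiber e) * P (joint_event s' A)))%E.
  rewrite -probability_joint_event_cons//=; last 2 first.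
  - by rewrite cs'.
  - by move=> c'; rewrite inE => /orP[/eqP->|/s'D].
  have := IH (c :: s') (set_event A e) (Z e) sD'.
  rewrite joint_event_cons//= indicI => <- //.
  - by apply: eq_integral => w _; rewrite mulrA.
  - by rewrite cs'.
  - by move=> c'; rewrite inE => /orP[/eqP->|/s'D].
  - move=> c' c's; rewrite inE negb_or; apply/andP; split.
      by apply: contraTneq c's => ->.
    by apply: ss'; rewrite inE c's orbT.
under eq_integral do rewrite YZ mulr_suml -sumEFin.
under [in RHS]eq_integral do rewrite YZ -sumEFin.
rewrite !ge0_integral_sum//.
- rewrite ge0_sume_distrl; last by move=> e _; apply: integral_ge0 => w _; rewrite lee_fin mulr_ge0.
  by apply: eq_bigr => e _; rewrite IH2 IH1 muleA.
- by move=> e; apply/measurable_EFinP; apply: measurable_funM => //; apply: measurable_indic.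
- by move=> e w _; rewrite lee_fin mulr_ge0.
- move=> e; apply/measurable_EFinP; apply: measurable_funM; last exact: measurable_indic.
  by apply: measurable_funM => //; apply: measurable_indic.
- by move=> e w _; rewrite lee_fin !mulr_ge0.
Qed.

Hypothesis X_unif : uniformly_distributed P D X.

(** Splitting over the values of [X c] leaves indicators that are independent of [Y e] and have
    probability [#|E c|%:R^-1]. This plays the role of conditional expectation given the past. *)
Lemma integral_fresh_draw (c : I) (s : seq I) (Y : E c -> Omega -> R) :
  {subset s <= D} -> c \in D -> c \notin s ->
  (forall e, determined s (Y e)) -> (forall e w, 0 <= Y e w) ->
  (\int[P]_w (Y (X c w) w)%:E
   = \int[P]_w (#|E c|%:R^-1 * \sum_e Y e w)%:E)%E.
Proof.
move=> sD cD cs dY Y0.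
have mY e : measurable_fun setT (Y e) by apply: (measurable_determined sD).
have mF (e : E c) := measurable_fiber e cD.
have YX w : Y (X c w) w = \sum_e Y e w * \1_(fiber e) w.
  rewrite (bigD1 (X c w))//= big1 ?addr0; last first.
    move=> e ne; rewrite indicE memNset ?mulr0// /fiber /= => h.
    by rewrite h eqxx in ne.
  by rewrite indicE mem_set// mulr1.
under eq_integral do rewrite YX -sumEFin.
under [in RHS]eq_integral do rewrite mulr_sumr -sumEFin.
rewrite !ge0_integral_sum//.
- apply: eq_bigr => e _.
  have := @integral_determined_indic s [:: c] (set_event (fun=> setT) e) (Y e) sD isT.
  rewrite joint_event_cons// /joint_event bigcap_seq big_nil setIT => -> //.
  + under [in RHS]eq_integral do rewrite EFinM.
    rewrite ge0_integralZl//; first by rewrite muleC X_unif.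
    * exact/measurable_EFinP.
    * by move=> w _; rewrite lee_fin.
  + by move=> c'; rewrite inE => /eqP->.
  + by move=> c' c's; rewrite inE; apply: contraTneq c's => ->.
- by move=> e; apply/measurable_EFinP; apply: measurable_funM.
- by move=> e w _; rewrite lee_fin mulr_ge0.
- by move=> e; apply/measurable_EFinP; apply: measurable_funM => //; apply: measurable_indic.
- by move=> e w _; rewrite lee_fin mulr_ge0.
Qed.
End FiniteSampling.

(** * Inner products and quadratic models *)

Section InnerProduct.
Context {R : realType} {d : nat}.
Implicit Types u v w : 'rV[R]_d.

Definition dot u v : R := \sum_(j < d) u ord0 j * v ord0 j.
Definition nsq u : R := dot u u.

Lemma dotC u v : dot u v = dot v u.
Proof. by apply: eq_bigr => j _; rewrite mulrC. Qed.

Lemma dotDl u v w : dot (u + v) w = dot u w + dot v w.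
Proof. by rewrite -big_split; apply: eq_bigr => j _ /=; rewrite mxE mulrDl. Qed.

Lemma dotZl a u v : dot (a *: u) v = a * dot u v.
Proof. by rewrite mulr_sumr; apply: eq_bigr => j _; rewrite mxE mulrA. Qed.

Lemma dotDr u v w : dot w (u + v) = dot w u + dot w v.
Proof. by rewrite dotC dotDl !(dotC w). Qed.

Lemma dotZr a u v : dot v (a *: u) = a * dot v u.
Proof. by rewrite dotC dotZl dotC. Qed.

Lemma dotNl u v : dot (- u) v = - dot u v.
Proof. by rewrite -scaleN1r dotZl mulN1r. Qed.

Lemma dotNr u v : dot v (- u) = - dot v u.
Proof. by rewrite dotC dotNl dotC. Qed.

Lemma dot_suml (n : nat) (u : 'I_n -> 'rV[R]_d) v :
  dot (\sum_i u i) v = \sum_i dot (u i) v.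
Proof.
elim/big_rec2 : _ => [|i a b _ <-]; last by rewrite dotDl.
by rewrite /dot big1// => j _; rewrite mxE mul0r.
Qed.

Definition dotE := (dotDl, dotDr, dotNl, dotNr, dotZl, dotZr).

Lemma nsq_ge0 u : 0 <= nsq u.
Proof. by apply: sumr_ge0 => j _; rewrite -expr2 sqr_ge0. Qed.

Lemma nsq_eq0 u : nsq u = 0 -> u = 0.
Proof.
move=> /eqP; rewrite psumr_eq0; last by move=> j _; rewrite -expr2 sqr_ge0.
move=> /allP u0; apply/rowP => j; rewrite mxE.
by have := u0 j (mem_index_enum j); rewrite mulf_eq0 orbb => /eqP.
Qed.

Lemma nsqD u v : nsq (u + v) = nsq u + 2 * dot u v + nsq v.
Proof. by rewrite /nsq !dotE (dotC v u); ring. Qed.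

Lemma nsqB u v : nsq (u - v) = nsq u - 2 * dot u v + nsq v.
Proof. by rewrite /nsq !dotE (dotC v u); ring. Qed.

Lemma nsqZ a u : nsq (a *: u) = a ^+ 2 * nsq u.
Proof. by rewrite /nsq !dotE; ring. Qed.

Lemma nsqN u : nsq (- u) = nsq u.
Proof. by rewrite /nsq !dotE opprK. Qed.

(** Expand [0 <= nsq (a *: u - v)] and divide by [a]. *)
Lemma dot_young (a : R) u v : 0 < a -> 2 * dot u v <= a * nsq u + a^-1 * nsq v.
Proof.
move=> a0; rewrite -(ler_pM2l a0) mulrDr (mulrA a a^-1) mulfV ?gt_eqF// mul1r.
have := nsq_ge0 (a *: u - v); rewrite nsqB nsqZ dotZl; lra.
Qed.

Lemma enorm_sqr u : enorm u ^+ 2 = nsq u.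
Proof.
rewrite /enorm sqr_sqrtr; first by apply: eq_bigr => j _; rewrite expr2.
by apply: sumr_ge0 => j _; rewrite sqr_ge0.
Qed.

Lemma enorm_ge0 u : 0 <= enorm u. Proof. exact: sqrtr_ge0. Qed.

End InnerProduct.

Section Descent.
Context {R : realType} {d : nat}.
Implicit Types (h : 'rV[R]_d -> R) (x v : 'rV[R]_d).

Lemma derive_grad h x v : differentiable h x -> 'D_v h x = dot (grad h x) v.
Proof.
move=> dh; rewrite deriveE// {1}(row_sum_delta v) linear_sum.
apply: eq_bigr => j _; rewrite linearZ /= mxE deriveE//.
by rewrite mulrC.
Qed.

Lemma is_derive_line h x v (t : R) : differentiable h (x + t *: v) ->
  is_derive t 1 (fun t => h (x + t *: v)) (dot (grad h (x + t *: v)) v).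
Proof.
move=> dh; have dv : derivable h (x + t *: v) v by exact: diff_derivable.
have e : (fun s : R => s^-1 *: (((fun t => h (x + t *: v)) \o shift t) (s *: (1:R)) - h (x + t *: v)))
  = (fun s => s^-1 *: ((h \o shift (x + t *: v)) (s *: v) - h (x + t *: v))).
  apply/funext => s /=; congr (_ *: (h _ - _)).
  by rewrite scalerDl [s *: 1]mulr1 addrCA.
apply: DeriveDef.
  by rewrite /derivable e.
by rewrite -derive_grad// /derive e.
Qed.

(** No integration is involved: along the segment, [h] minus its quadratic model is [q] up to a
    constant, whose derivative is nonpositive on the open unit interval. *)
Lemma descent h (l : R) x v : 0 < l ->
  (forall x, differentiable h x) ->
  (forall x v, nsq (grad h (x + v) - grad h x) <= l ^+ 2 * nsq v) ->
  h (x + v) <= h x + dot (grad h x) v + l / 2 * nsq v.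
Proof.
move=> l0 dh lip.
pose p (t : R) := h (x + t *: v).
pose q (t : R) := p t - (t * dot (grad h x) v + l / 2 * nsq v * t ^+ 2).
have dp t := is_derive_line (dh (x + t *: v)).
have dq (t : R) : is_derive t (1 : R) q
  (dot (grad h (x + t *: v)) v - (dot (grad h x) v + l * nsq v * t)).
  apply: is_deriveB; apply: is_derive_eq.
  by rewrite /GRing.scale /=; field.
have q10 : q 1 <= q 0.
  apply: (@ler0_derive1_le_cc _ q 0 1) => //; rewrite ?in_itv/= ?lexx ?ler01//.
  - move=> t; rewrite in_itv /= => /andP[t0 _].
    rewrite derive1E (@derive_val _ _ _ _ _ _ _ (dq t)).
    (* With this weight both terms of Young's inequality are at most [l * t * nsq v]. *)
    have lt0 : 0 < (l * t)^-1 by rewrite invr_gt0 mulr_gt0.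
    have := dot_young (grad h (x + t *: v) - grad h x) v lt0.
    have := lip x (t *: v); rewrite nsqZ => /(ler_wpM2l (ltW lt0)).
    rewrite invrK dotDl dotNl.
    have -> : (l * t)^-1 * (l ^+ 2 * (t ^+ 2 * nsq v)) = l * t * nsq v.
      by field; rewrite !gt_eqF.
    lra.
  - apply: derivable_within_continuous => t _; exact: ex_derive.
move: q10; rewrite /q /p scale1r scale0r addr0; lra.
Qed.

Lemma gradN h x : differentiable h x -> grad (- h) x = - grad h x.
Proof.
by move=> dh; apply/rowP => j; rewrite !mxE deriveN//; exact: diff_derivable.
Qed.

Lemma descent_lower h (l : R) x v : 0 < l ->
  (forall x, differentiable h x) ->
  (forall x v, nsq (grad h (x + v) - grad h x) <= l ^+ 2 * nsq v) ->
  h x + dot (grad h x) v - l / 2 * nsq v <= h (x + v).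
Proof.
move=> l0 dh lip.
have dN y : differentiable (- h) y by exact: differentiableN.
have := @descent (- h) l x v l0 dN; rewrite gradN// dotNl !fctE => H.
suff : - h (x + v) <= - h x - dot (grad h x) v + l / 2 * nsq v by lra.
by apply: H => y w; rewrite !gradN// -opprD nsqN.
Qed.

End Descent.

(** * Averages over the component index *)

Section Mean.
Context {R : realType} {n : nat}.
Implicit Types u v : 'I_n -> R.

(** The conditional expectation over one fresh index, in the form produced by
    [integral_fresh_draw]. *)
Definition mean u : R := n%:R^-1 * \sum_i u i.

Lemma meanD u v : mean (fun i => u i + v i) = mean u + mean v.
Proof. by rewrite /mean big_split mulrDr. Qed.

Lemma meanZ a u : mean (fun i => a * u i) = a * mean u.
Proof. by rewrite /mean -mulr_sumr mulrCA. Qed.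

Lemma mean_le u v : (forall i, u i <= v i) -> mean u <= mean v.
Proof. by move=> uv; rewrite ler_wpM2l ?invr_ge0//; apply: ler_sum. Qed.

Lemma mean_ge0 u : (forall i, 0 <= u i) -> 0 <= mean u.
Proof. by move=> u0; rewrite mulr_ge0 ?invr_ge0// sumr_ge0. Qed.

Hypothesis n0 : (0 < n)%N.

Lemma mean_cst (a : R) : mean (fun=> a) = a.
Proof.
rewrite /mean sumr_const card_ord -(mulr_natl a) mulrA mulVf ?mul1r//.
by rewrite pnatr_eq0 -lt0n.
Qed.

Context {d : nat}.
Implicit Types w : 'I_n -> 'rV[R]_d.

Definition vmean w : 'rV[R]_d := n%:R^-1 *: \sum_i w i.

Lemma vmeanD w1 w2 : vmean (fun i => w1 i + w2 i) = vmean w1 + vmean w2.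
Proof. by rewrite /vmean big_split scalerDr. Qed.

Lemma vmeanB w1 w2 : vmean (fun i => w1 i - w2 i) = vmean w1 - vmean w2.
Proof. by rewrite /vmean sumrB scalerBr. Qed.

Lemma vmean_cst (a : 'rV[R]_d) : vmean (fun=> a) = a.
Proof.
rewrite /vmean sumr_const card_ord -(scaler_nat n a) scalerA mulVf ?scale1r//.
by rewrite pnatr_eq0 -lt0n.
Qed.

Lemma mean_dot w (a : 'rV[R]_d) : mean (fun i => dot a (w i)) = dot a (vmean w).
Proof.
rewrite /vmean dotZr dotC dot_suml /mean; congr (_ * _).
by apply: eq_bigr => i _; rewrite dotC.
Qed.

(** Unbiasedness enters here: the linear term sees the stochastic gradients only through
    [vmean w]. *)
Lemma mean_quadratic_le (phi : 'I_n -> R) (a c : R) (b : 'rV[R]_d) w :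
  (forall i, phi i <= a + dot b (w i) + c * nsq (w i)) ->
  mean phi <= a + dot b (vmean w) + c * mean (fun i => nsq (w i)).
Proof.
move=> /mean_le /le_trans; apply; rewrite !meanD mean_cst mean_dot.
by rewrite meanZ.
Qed.

(** The left side exceeds [nsq (vmean w1)] by the variance of [w1 i - w2 i], which is at most its
    second moment. *)
Lemma mean_nsq_control_variate w1 w2 :
  mean (fun i => nsq (w1 i - w2 i + vmean w2))
    <= nsq (vmean w1) + mean (fun i => nsq (w1 i - w2 i)).
Proof.
set b := vmean w2.
have -> : mean (fun i => nsq (w1 i - w2 i + b)) =
    nsq b + dot (2 *: b) (vmean w1 - b) + 1 * mean (fun i => nsq (w1 i - w2 i)).
  rewrite -vmeanB -mean_dot -[in 1 * _]meanZ -{1}(mean_cst (nsq b)) -!meanD.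
  congr mean; apply/funext => i.
  by rewrite nsqD dotZl (dotC b); ring.
have := nsq_ge0 (vmean w1 - b); rewrite dotZl nsqB dotDr dotNr (dotC b) -/(nsq b); lra.
Qed.

Lemma nsq_vmean_le w : nsq (vmean w) <= mean (fun i => nsq (w i)).
Proof.
have := mean_ge0 (fun i => nsq_ge0 (w i - vmean w)).
have -> : mean (fun i => nsq (w i - vmean w)) =
    mean (fun i => nsq (w i)) + dot (- 2 *: vmean w) (vmean w) + nsq (vmean w).
  rewrite -mean_dot -(mean_cst (nsq (vmean w))) -!meanD.
  congr mean; apply/funext => i.
  by rewrite nsqB dotZl (dotC (vmean w)); ring.
rewrite dotZl -/(nsq _); lra.
Qed.

Lemma differentiable_mean (h : 'I_n -> 'rV[R]_d -> R) x :
  (forall i, differentiable (h i) x) ->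
  differentiable (fun x => mean (h ^~ x)) x.
Proof.
move=> dh.
have -> : (fun x => mean (h ^~ x)) = n%:R^-1 *: \sum_i h i.
  by apply/funext => y; rewrite /mean !fctE fct_sumE.
by apply: differentiableZ; apply: differentiable_sum.
Qed.

Lemma grad_mean (h : 'I_n -> 'rV[R]_d -> R) x :
  (forall i, differentiable (h i) x) ->
  grad (fun x => mean (h ^~ x)) x = vmean (fun i => grad (h i) x).
Proof.
move=> dh; apply/rowP => j; rewrite !mxE summxE.
have -> : (fun x => mean (h ^~ x)) = n%:R^-1 *: \sum_i h i.
  by apply/funext => y; rewrite /mean !fctE fct_sumE.
rewrite deriveZ; last by apply: derivable_sum => i; exact: diff_derivable.
rewrite derive_sum; last by move=> i; exact: diff_derivable.
by rewrite /GRing.scale /=; congr (_ * _); apply: eq_bigr => i _; rewrite mxE.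
Qed.
End Mean.

(** * The primal function and one inner step *)

Section OptimalValues.
Context {R : realType} {d1 d2 : nat}.
Variable F : 'rV[R]_d1 -> 'rV[R]_d2 -> R.

Lemma maxy_attained : partial_maxima_attained F ->
  forall x, exists y0, maxy F x = F x y0.
Proof.
move=> att x; have [y0 h] := att x; exists y0; apply/eqP; rewrite eq_le.
apply/andP; split.
  by apply: ge_sup => [|_ [y _ <-]//]; exists (F x y0), y0.
by apply: ub_le_sup; [exists (F x y0) => _ [y _ <-]|exists y0].
Qed.

Lemma le_maxy : partial_maxima_attained F -> forall x y, F x y <= maxy F x.
Proof.
move=> att x y; have [y0 h] := att x.
by apply: ub_le_sup; [exists (F x y0) => _ [y' _ <-]|exists y].
Qed.

Lemma minx_le : partial_minima_attained F -> forall x y, minx F y <= F x y.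
Proof.
move=> att x y; have [x0 h] := att y.
by apply: ge_inf; [exists (F x0 y) => _ [x' _ <-]|exists x].
Qed.

Hypothesis att : partial_maxima_attained F.
Hypothesis saddle : has_saddle_point F.

(** The saddle value bounds [maxy F] from below, so the infimum is a genuine one and not a default
    value. *)
Lemma minimax_le x : minimax F <= maxy F x.
Proof.
have [xs [ys h]] := saddle.
apply: ge_inf; last by exists x.
exists (F xs ys) => _ [x' _ <-]; apply: le_trans (le_maxy att x' ys).
by have [] := h x' ys.
Qed.

(** The saddle value separates the two sides. This turns the PL condition of a slice [F ^~ y] into
    one for the primal function. *)
Lemma minx_le_minimax y : partial_minima_attained F -> minx F y <= minimax F.
Proof.
move=> atm; have [xs [ys h]] := saddle.
apply: le_trans (minx_le atm xs y) _.
apply: le_trans (h xs y).1 _.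
apply: lb_le_inf; first by exists (maxy F xs), xs.
move=> _ [x _ <-]; apply: le_trans (le_maxy att x ys).
by have [] := h x ys.
Qed.
End OptimalValues.

(** * Regularity of the averaged objective *)

Section Average.
Context {R : realType} {d1 d2 n : nat}.
Variables (f : 'I_n -> 'rV[R]_d1 -> 'rV[R]_d2 -> R) (l : R).
Local Notation F := (average f).
Hypothesis n0 : (0 < n)%N.
Hypothesis l0 : 0 < l.
Hypothesis cdf : forall i, continuously_differentiable (f i).
Hypothesis lipf : forall i, lipschitz_gradients l (f i).

Lemma differentiable_slice_x i x y : differentiable (f i ^~ y) x.
Proof.
have [dF _] := cdf i.
apply: (@differentiable_comp _ _ _ _ (fun x => (x, y)) (fun z => f i z.1 z.2)).
  exact: differentiable_pair.
exact: dF.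
Qed.

Lemma differentiable_slice_y i x y : differentiable (f i x) y.
Proof.
have [dF _] := cdf i.
apply: (@differentiable_comp _ _ _ _ (fun y => (x, y)) (fun z => f i z.1 z.2)).
  exact: differentiable_pair.
exact: dF.
Qed.

Lemma gradx_average x y : gradx F x y = vmean (fun i => gradx (f i) x y).
Proof. by apply: grad_mean => // i; exact: differentiable_slice_x. Qed.

Lemma grady_average x y : grady F x y = vmean (fun i => grady (f i) x y).
Proof. by apply: grad_mean => // i; exact: differentiable_slice_y. Qed.

Lemma component_lipschitz i x1 x2 y1 y2 :
  nsq (gradx (f i) x1 y1 - gradx (f i) x2 y2)
    <= l ^+ 2 * (enorm (x1 - x2) + enorm (y1 - y2)) ^+ 2 /\
  nsq (grady (f i) x1 y1 - grady (f i) x2 y2)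
    <= l ^+ 2 * (enorm (x1 - x2) + enorm (y1 - y2)) ^+ 2.
Proof.
have [hx hy] := lipf i x1 x2 y1 y2.
by rewrite -!enorm_sqr -exprMn; split; apply: lerXn2r; rewrite ?nnegrE ?enorm_ge0//;
   rewrite mulr_ge0 ?addr_ge0 ?enorm_ge0 ?ltW.
Qed.

Lemma average_lipschitz x1 x2 y1 y2 :
  nsq (gradx F x1 y1 - gradx F x2 y2)
    <= l ^+ 2 * (enorm (x1 - x2) + enorm (y1 - y2)) ^+ 2 /\
  nsq (grady F x1 y1 - grady F x2 y2)
    <= l ^+ 2 * (enorm (x1 - x2) + enorm (y1 - y2)) ^+ 2.
Proof.
rewrite !gradx_average !grady_average -!vmeanB.
split; apply: le_trans (nsq_vmean_le n0 _) _.
  rewrite -[leRHS](mean_cst n0); apply: mean_le => i.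
  by have [] := component_lipschitz i x1 x2 y1 y2.
rewrite -[leRHS](mean_cst n0); apply: mean_le => i.
by have [] := component_lipschitz i x1 x2 y1 y2.
Qed.

Lemma enorm0 (d : nat) : enorm (0 : 'rV[R]_d) = 0.
Proof. by rewrite /enorm big1 ?sqrtr0// => j _; rewrite mxE expr0n. Qed.

Lemma average_upper_x x v y :
  F (x + v) y <= F x y + dot (gradx F x y) v + l / 2 * nsq v.
Proof.
apply: (@descent _ _ (F ^~ y)) => // [x'|x' v'].
  by apply: differentiable_mean => i; exact: differentiable_slice_x.
have [+ _] := average_lipschitz (x' + v') x' y y.
by rewrite subrr enorm0 addr0 (addrC x') addrK enorm_sqr.
Qed.

Lemma average_lower_x x v y :
  F x y + dot (gradx F x y) v - l / 2 * nsq v <= F (x + v) y.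
Proof.
apply: (@descent_lower _ _ (F ^~ y)) => // [x'|x' v'].
  by apply: differentiable_mean => i; exact: differentiable_slice_x.
have [+ _] := average_lipschitz (x' + v') x' y y.
by rewrite subrr enorm0 addr0 (addrC x') addrK enorm_sqr.
Qed.

Lemma average_lower_y x y v :
  F x y + dot (grady F x y) v - l / 2 * nsq v <= F x (y + v).
Proof.
apply: (@descent_lower _ _ (F x)) => // [y'|y' v'].
  by apply: differentiable_mean => i; exact: differentiable_slice_y.
have [_ +] := average_lipschitz x x (y' + v') y'.
by rewrite subrr enorm0 add0r (addrC y') addrK enorm_sqr.
Qed.

(* The control variate turns the variance of both stochastic gradients into the
   squared distance to the anchor. *)
Lemma component_deviation i x1 x2 y1 y2 :
  nsq (gradx (f i) x1 y1 - gradx (f i) x2 y2)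
    <= 2 * l ^+ 2 * (nsq (x1 - x2) + nsq (y1 - y2)) /\
  nsq (grady (f i) x1 y1 - grady (f i) x2 y2)
    <= 2 * l ^+ 2 * (nsq (x1 - x2) + nsq (y1 - y2)).
Proof.
have [hx hy] := component_lipschitz i x1 x2 y1 y2.
suff h : l ^+ 2 * (enorm (x1 - x2) + enorm (y1 - y2)) ^+ 2
    <= 2 * l ^+ 2 * (nsq (x1 - x2) + nsq (y1 - y2)).
  by split; apply: le_trans h.
rewrite (mulrC 2) -(mulrA (l ^+ 2) 2) ler_pM2l ?exprn_gt0// -!enorm_sqr.
have := sqr_ge0 (enorm (x1 - x2) - enorm (y1 - y2)); lra.
Qed.

(** * The primal function under the two-sided PL condition *)

Variables (mu1 mu2 r : R).
Hypothesis saddle : has_saddle_point F.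
Hypothesis atm : partial_minima_attained F.
Hypothesis att : partial_maxima_attained F.
(** [r] stands for kappa; the PL constants are used through their common lower bound [l / r]. *)
Hypothesis r1 : 1 <= r.
Hypothesis mu1r : l / r <= mu1.
Hypothesis mu2r : l / r <= mu2.
Hypothesis PL : two_sided_PL mu1 mu2 F.

Local Notation M := (maxy F).

(** A step of [l^-1] along the gradient would raise [F x] by at least
    [(2 * l)^-1 * nsq (grady F x y)], which is impossible at a maximiser unless the gradient
    vanishes. *)
Lemma grady_argmax x y : M x = F x y -> grady F x y = 0.
Proof.
move=> e; apply: nsq_eq0; apply/eqP; rewrite eq_le nsq_ge0 andbT.
have := average_lower_y x y (l^-1 *: grady F x y).
have := le_maxy att x (y + l^-1 *: grady F x y).
rewrite e dotZr nsqZ -/(nsq (grady F x y)) => h1 h2.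
have := le_trans h2 h1; rewrite -addrA gerDl.
have -> : l^-1 * nsq (grady F x y) - l / 2 * (l^-1 ^+ 2 * nsq (grady F x y))
   = (2 * l)^-1 * nsq (grady F x y) by field; rewrite gt_eqF.
by rewrite pmulr_rle0// invr_gt0 mulr_gt0.
Qed.

(* No regularity of [M] is presupposed: the PL condition at [x + v], evaluated
   at a maximiser for [x], bounds the increase of [M]. *)
Lemma maxy_upper x y v : M x = F x y ->
  M (x + v) <= M x + dot (gradx F x y) v + l * r * nsq v.
Proof.
move=> e; have g0 := grady_argmax e.
have r0 : 0 < r by apply: lt_le_trans r1.
have [_ hPL] := PL (x + v) y.
have [_ +] := average_lipschitz (x + v) x y y.
rewrite g0 subr0 subrr enorm0 addr0 (addrC x) addrK enorm_sqr -(addrC x) => hl.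
rewrite enorm_sqr in hPL.
have b0 : 0 <= M (x + v) - F (x + v) y by rewrite subr_ge0 le_maxy.
have h : 2 * (l / r) * (M (x + v) - F (x + v) y) <= l ^+ 2 * nsq v.
  by apply: le_trans (le_trans hPL hl); rewrite ler_wpM2r// ler_pM2l.
have hb : M (x + v) - F (x + v) y <= l * r / 2 * nsq v.
  have c0 : 0 < 2 * (l / r) by rewrite mulr_gt0// divr_gt0.
  rewrite -(ler_pM2l c0); apply: le_trans h _; rewrite le_eqVlt; apply/orP; left.
  by apply/eqP; field; rewrite gt_eqF.
have hu := average_upper_x x v y.
(* Since [1 <= r], the upper model of [F ^~ y] and the PL bound each contribute at most
   [l * r / 2 * nsq v]. *)
have hv : l / 2 * nsq v <= l * r / 2 * nsq v.
  rewrite ler_wpM2r ?nsq_ge0// ler_pM2r ?invr_gt0//.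
  by rewrite -{1}[l]mulr1 ler_pM2l.
rewrite e; lra.
Qed.

(* Both models of [F ^~ y] and [M] meet in a quadratic of curvature 3lr, so the
   gap [M x - F x y] controls the difference of the gradients. *)
Lemma gradx_deviation x y0 y : M x = F x y0 ->
  nsq (gradx F x y0 - gradx F x y) <= 6 * (l * r) * (M x - F x y).
Proof.
move=> e; set w := gradx F x y0 - gradx F x y.
have r0 : 0 < r by apply: lt_le_trans r1.
have lr0 : 0 < l * r by rewrite mulr_gt0.
(* The minimiser of [dot w v + 3 / 2 * (l * r) * nsq v], with minimum
   [- (6 * (l * r))^-1 * nsq w]. *)
pose v := - (3 * (l * r))^-1 *: w.
have h1 := maxy_upper v e.
have h2 := average_lower_x x v y.
have h3 := le_maxy att (x + v) y.
have hv : l / 2 * nsq v <= l * r / 2 * nsq v.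
  rewrite ler_wpM2r ?nsq_ge0// ler_pM2r ?invr_gt0//.
  by rewrite -{1}[l]mulr1 ler_pM2l.
have hw : dot (gradx F x y0) v - dot (gradx F x y) v
    = - (3 * (l * r))^-1 * nsq w.
  by rewrite -dotNl -dotDl dotZr.
have hvv : nsq v = (3 * (l * r))^-1 ^+ 2 * nsq w by rewrite nsqZ sqrrN.
have k : (3 * (l * r))^-1 * nsq w - (3 / 2) * (l * r) * nsq v
    = (6 * (l * r))^-1 * nsq w by rewrite hvv; field; rewrite gt_eqF ?gt_eqF//.
have : (6 * (l * r))^-1 * nsq w <= M x - F x y by lra.
by rewrite ler_pdivrMl ?mulr_gt0.
Qed.

(** The PL condition of the slice at a maximiser [y0], where [F x y0 = M x], is a PL inequality for
    [M] with [gradx F x y0] in the role of its gradient. *)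
Lemma primal_PL x y0 : M x = F x y0 ->
  2 * (l / r) * (M x - minimax F) <= nsq (gradx F x y0).
Proof.
move=> e; have [h _] := PL x y0; rewrite enorm_sqr -e in h.
apply: le_trans h; have m0 := minx_le_minimax att saddle y0 atm.
have a0 := minimax_le att saddle x.
have r0 : 0 < r by apply: lt_le_trans r1.
have c0 : 0 < l / r by rewrite divr_gt0.
apply: le_trans (_ : 2 * mu1 * (M x - minimax F) <= _).
  by rewrite ler_wpM2r ?subr_ge0// ler_pM2l.
have mu10 : 0 < 2 * mu1 by rewrite mulr_gt0// (lt_le_trans c0).
by rewrite ler_pM2l// lerD2l lerN2.
Qed.

(** * Expected change of the potential in one inner step *)

Variables (t1 t2 th : R).
Hypothesis t1_gt0 : 0 < t1.
(** [th] weights Young's inequality between a step and the displacement from the anchor; it is later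
    [(16 * N)^-1]. *)
Hypothesis th_gt0 : 0 < th.
Hypothesis t2E : t2 = 28 * r ^+ 2 * t1.

Implicit Types a z : ('rV[R]_d1 * 'rV[R]_d2)%type.

Definition anchor_dist a z : R := nsq (z.1 - a.1) + nsq (z.2 - a.2).

Definition gap z : R :=
  M z.1 - minimax F + 20^-1 * (M z.1 - F z.1 z.2).

Definition vr_gradx a i z :=
  gradx (f i) z.1 z.2 - gradx (f i) a.1 a.2 + gradx F a.1 a.2.

Definition vr_grady a i z :=
  grady (f i) z.1 z.2 - grady (f i) a.1 a.2 + grady F a.1 a.2.

Lemma vmean_vr_gradx a z : vmean (fun i => vr_gradx a i z) = gradx F z.1 z.2.
Proof. by rewrite vmeanD vmeanB vmean_cst// -!gradx_average subrK. Qed.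

Lemma vmean_vr_grady a z : vmean (fun i => vr_grady a i z) = grady F z.1 z.2.
Proof. by rewrite vmeanD vmeanB vmean_cst// -!grady_average subrK. Qed.

Lemma mean_nsq_vr_gradx a z : mean (fun i => nsq (vr_gradx a i z))
  <= nsq (gradx F z.1 z.2) + 2 * l ^+ 2 * anchor_dist a z.
Proof.
have := mean_nsq_control_variate n0
  (fun i => gradx (f i) z.1 z.2) (fun i => gradx (f i) a.1 a.2).
rewrite -!gradx_average => /le_trans; apply.
rewrite lerD2l -[leRHS](mean_cst n0); apply: mean_le => i.
by have [] := component_deviation i z.1 a.1 z.2 a.2.
Qed.

Lemma mean_nsq_vr_grady a z : mean (fun i => nsq (vr_grady a i z))
  <= nsq (grady F z.1 z.2) + 2 * l ^+ 2 * anchor_dist a z.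
Proof.
have := mean_nsq_control_variate n0
  (fun i => grady (f i) z.1 z.2) (fun i => grady (f i) a.1 a.2).
rewrite -!grady_average => /le_trans; apply.
rewrite lerD2l -[leRHS](mean_cst n0); apply: mean_le => i.
by have [] := component_deviation i z.1 a.1 z.2 a.2.
Qed.

(** The lower model of [F z.1] and the squared distance are quadratic in the stochastic gradient.
    Its mean enters the linear term, the control variate bounds its square, and Young's inequality
    with [th] handles the cross term. *)
Lemma dual_step (c : R) a z : 0 <= c ->
  mean (fun k => 20^-1 * - F z.1 (z.2 + t2 *: vr_grady a k z)
                 + c * nsq (z.2 + t2 *: vr_grady a k z - a.2))
  <= 20^-1 * - F z.1 z.2 + c * (1 + th) * nsq (z.2 - a.2)
     - (20^-1 * t2 * (1 - l * t2 / 2) - c * (t2 ^+ 2 / th + t2 ^+ 2))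
         * nsq (grady F z.1 z.2)
     + (20^-1 * l / 2 + c) * t2 ^+ 2 * (2 * l ^+ 2) * anchor_dist a z.
Proof.
move=> c0; set H := grady F z.1 z.2; set e := z.2 - a.2.
pose C := (20^-1 * l / 2 + c) * t2 ^+ 2.
have C0 : 0 <= C by rewrite mulr_ge0 ?sqr_ge0// addr_ge0// !mulr_ge0// ltW.
have := @mean_quadratic_le _ _ n0 _
  (fun k => 20^-1 * - F z.1 (z.2 + t2 *: vr_grady a k z)
            + c * nsq (z.2 + t2 *: vr_grady a k z - a.2))
  (20^-1 * - F z.1 z.2 + c * nsq e) C
  ((2 * c * t2) *: e - (20^-1 * t2) *: H)
  (fun k => vr_grady a k z).
rewrite vmean_vr_grady -/H => h; apply: le_trans (h _) _ => {h} [k|].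
  have := average_lower_y z.1 z.2 (t2 *: vr_grady a k z).
  have -> : z.2 + t2 *: vr_grady a k z - a.2 = e + t2 *: vr_grady a k z.
    by rewrite /e addrAC.
  move: (F _ (_ + _)) (F _ _) => F1 F2; rewrite nsqD !dotE nsqZ -/H /C.
  move: (dot H _) (dot z.2 _) (dot a.2 _) (nsq e) (nsq _) => *; lra.
have hm := ler_wpM2l C0 (mean_nsq_vr_grady a z).
have := ler_wpM2l c0 (dot_young e (t2 *: H) th_gt0).
rewrite dotZr nsqZ !dotE -/(nsq H) -/H in hm *; rewrite /C in hm *; lra.
Qed.

(** Same scheme as [dual_step]. [M] enters through an upper model with slope [G]; [F ^~ z.2] occurs
    with a negative sign, so its lower model is used. *)
Lemma primal_step (c w : R) a z G : 0 <= c -> 0 <= w ->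
  (forall v, M (z.1 + v) <= M z.1 + dot G v + l * r * nsq v) ->
  mean (fun k => (1 + w) * M (z.1 - t1 *: vr_gradx a k z)
                 + w * - F (z.1 - t1 *: vr_gradx a k z) z.2
                 + c * nsq (z.1 - t1 *: vr_gradx a k z - a.1))
  <= (1 + w) * M z.1 + w * - F z.1 z.2 + c * (1 + th) * nsq (z.1 - a.1)
     - (1 + w) * t1 * dot G (gradx F z.1 z.2)
     + (w * t1 + c * (t1 ^+ 2 / th)) * nsq (gradx F z.1 z.2)
     + ((1 + w) * (l * r) + w * (l / 2) + c) * t1 ^+ 2
         * (nsq (gradx F z.1 z.2) + 2 * l ^+ 2 * anchor_dist a z).
Proof.
move=> c0 w0 hG; set D := gradx F z.1 z.2; set e := z.1 - a.1.
pose C := ((1 + w) * (l * r) + w * (l / 2) + c) * t1 ^+ 2.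
have r0 : 0 < r by apply: lt_le_trans r1.
have C0 : 0 <= C.
  rewrite mulr_ge0 ?sqr_ge0// !addr_ge0// !mulr_ge0// ?addr_ge0// ltW//.
have := @mean_quadratic_le _ _ n0 _
  (fun k => (1 + w) * M (z.1 - t1 *: vr_gradx a k z)
            + w * - F (z.1 - t1 *: vr_gradx a k z) z.2
            + c * nsq (z.1 - t1 *: vr_gradx a k z - a.1))
  ((1 + w) * M z.1 + w * - F z.1 z.2 + c * nsq e) C
  (- ((1 + w) * t1) *: G + (w * t1) *: D - (2 * c * t1) *: e)
  (fun k => vr_gradx a k z).
rewrite vmean_vr_gradx -/D => h; apply: le_trans (h _) _ => {h} [k|].
  have h1 := average_lower_x z.1 (- (t1 *: vr_gradx a k z)) z.2.
  have h2 := hG (- (t1 *: vr_gradx a k z)).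
  rewrite !dotE nsqN nsqZ -/D in h1; rewrite !dotE nsqN nsqZ in h2.
  have w1 : 0 <= 1 + w by rewrite addr_ge0.
  have -> : z.1 - t1 *: vr_gradx a k z - a.1 = e - t1 *: vr_gradx a k z.
    by rewrite /e addrAC.
  have := ler_wpM2l w0 h1; have := ler_wpM2l w1 h2.
  rewrite nsqB !dotE nsqZ -/D /C.
  move: (F (_ - _) _) (F _ _) (M (_ - _)) (M z.1) => F1 F2 M1 M2.
  move: (dot G _) (dot D _) (dot z.1 _) (dot a.1 _) (nsq e) (nsq _) => *; lra.
have hm := ler_wpM2l C0 (mean_nsq_vr_gradx a z).
have := ler_wpM2l c0 (dot_young (- e) (t1 *: D) th_gt0).
rewrite nsqN dotZr nsqZ !dotE -/(nsq D) -/D in hm *; rewrite /C in hm *; lra.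
Qed.

(* Young's inequality with weight 7/5 leaves a constant below 133/50, the gain of
   the dual step: this is where the ratio 28 kappa^2 of the stepsizes and the
   factor 1/20 of the potential are used. *)
Lemma gradient_pairing_le (T b : R) (G D : 'rV[R]_d1) :
  0 <= T <= 20^-1 -> nsq (G - D) <= 6 * (l * r) * b ->
  - (1 + T) * dot G D + (T + 100^-1) * nsq D
    <= - (3 / 10) * nsq G + 59 / 25 * (l * r * b).
Proof.
move=> /andP[T0 T1] he; set e := G - D in he.
have -> : D = G - e by rewrite /e opprB addrC subrK.
rewrite nsqB dotDr dotNr -/(nsq G).
have y0 : 0 < 7 / 5 :> R by lra.
(* After substituting [G - e] for [D], the coefficient of [dot G e] is exactly [49 / 50 - T]. *)
have := dot_young G e y0; have T98 : 0 <= 49 / 50 - T by lra.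
move=> /(ler_wpM2l T98).
have := nsq_ge0 e; have := nsq_ge0 G; have := mulr_ge0 T0 (nsq_ge0 G).
have T20 : 0 <= 20^-1 - T by lra.
have := mulr_ge0 T20 (nsq_ge0 e).
rewrite invf_div; lra.
Qed.

Variables (c c' : R).
(** [c] and [c'] weight the squared anchor distance before and after the step; [c1] is the weight
    between the two updates, [c'] plus what the variance of the y-update costs. *)
Let c1 := c' + (20^-1 * l / 2 + c') * t2 ^+ 2 * (2 * l ^+ 2).
Hypothesis c'_ge0 : 0 <= c'.
(** Equivalent to [0 <= w] for the weight [w] below. *)
Hypothesis t1_small : 266 / 5 * (l * r * t1) <= 1.
Hypothesis t2_small : l * t2 / 2 + 20 * c' * (t2 / th + t2) <= 20^-1.
Hypothesis drift_small : 11 / 10 * (l * r) * t1 + c1 * (t1 + t1 / th) <= 100^-1.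
Hypothesis weight_recursion :
  c1 * (1 + th) + (11 / 10 * (l * r) + c1) * t1 ^+ 2 * (2 * l ^+ 2) <= c.

Lemma gap_ge0 z : 0 <= gap z.
Proof.
by rewrite addr_ge0// ?mulr_ge0// subr_ge0 ?minimax_le// le_maxy.
Qed.

Lemma anchor_dist_ge0 a z : 0 <= anchor_dist a z.
Proof. by rewrite addr_ge0// nsq_ge0. Qed.

(** What remains of the weight [20^-1] after the dual gain: by [t2_small] the squared y-gradient has
    coefficient at least [19 / 400 * t2], and PL with [t2 = 28 * r ^+ 2 * t1] turns this into
    [133 / 50 * (l * r * t1)] times the dual gap. *)
Let w := 20^-1 - 133 / 50 * (l * r * t1).

(** The bound depends on the new [x'] in the shape treated by [primal_step], so that the average
    over the first index can follow. *)
Lemma dual_step_gap a z x' :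
  mean (fun k => let y' := z.2 + t2 *: vr_grady a k (x', z.2) in
                 gap (x', y') + c' * anchor_dist a (x', y'))
  <= (1 + w) * M x' + w * - F x' z.2 - minimax F
     + c1 * nsq (x' - a.1) + c1 * (1 + th) * nsq (z.2 - a.2).
Proof.
have r0 : 0 < r by apply: lt_le_trans r1.
have t20 : 0 < t2 by rewrite t2E !mulr_gt0// exprn_gt0.
set N2 := nsq (x' - a.1); set N3 := nsq (z.2 - a.2).
have -> : mean (fun k => let y' := z.2 + t2 *: vr_grady a k (x', z.2) in
                 gap (x', y') + c' * anchor_dist a (x', y')) =
   ((1 + 20^-1) * M x' - minimax F + c' * N2) +
   mean (fun k => 20^-1 * - F x' (z.2 + t2 *: vr_grady a k (x', z.2))
                 + c' * nsq (z.2 + t2 *: vr_grady a k (x', z.2) - a.2)).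
  rewrite -[X in X + mean _](mean_cst n0) -meanD.
  by congr mean; apply/funext => k; rewrite /gap /anchor_dist /N2 /=; ring.
have := @dual_step c' a (x', z.2) c'_ge0.
rewrite /anchor_dist /= -/N2 -/N3 => h; apply: le_trans (lerD (lexx _) h) _.
set H := nsq (grady F x' z.2).
have b0 : 0 <= M x' - F x' z.2 by rewrite subr_ge0 le_maxy.
have hPL : 2 * (l / r) * (M x' - F x' z.2) <= H.
  have [_] := PL x' z.2; rewrite enorm_sqr; apply: le_trans.
  by rewrite ler_wpM2r// ler_pM2l.
have hH : 133 / 50 * (l * r * t1) * (M x' - F x' z.2) <=
  (20^-1 * t2 * (1 - l * t2 / 2) - c' * (t2 ^+ 2 / th + t2 ^+ 2)) * H.
  apply: le_trans (_ : 19 / 400 * t2 * H <= _).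
    apply: le_trans (_ : 19 / 400 * t2 * (2 * (l / r) * (M x' - F x' z.2)) <= _).
      rewrite le_eqVlt; apply/orP; left; rewrite t2E; apply/eqP; field.
      by rewrite gt_eqF.
    by apply: ler_wpM2l hPL; lra.
  apply: ler_wpM2r; first exact: nsq_ge0.
  have := ler_wpM2l (ltW t20) t2_small; lra.
have N30 : 0 <= N3 by apply: nsq_ge0.
have p0 : 0 <= (20^-1 * l / 2 + c') * t2 ^+ 2 * (2 * l ^+ 2).
  rewrite mulr_ge0 ?mulr_ge0 ?addr_ge0// ?mulr_ge0 ?exprn_ge0// ltW//.
have := mulr_ge0 (mulr_ge0 p0 (ltW th_gt0)) N30.
rewrite /w /c1; lra.
Qed.

(** Average over the second index by [dual_step_gap], then over the first by [primal_step]. The dual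
    gap is left with [59 / 25 - 133 / 50 = - 3 / 10] times [l * r * t1], and
    [- (3 / 10) * t1 * nsq G] pays for the primal gap through [primal_PL]. *)
Lemma vr_step_gap a z :
  mean (fun i => mean (fun k =>
    gap (vr_step f t1 t2 a i k z) + c' * anchor_dist a (vr_step f t1 t2 a i k z)))
  + t1 * l / (2 * r) * gap z <= gap z + c * anchor_dist a z.
Proof.
have r0 : 0 < r by apply: lt_le_trans r1.
have lr0 : 0 < l * r by rewrite mulr_gt0.
have t20 : 0 < t2 by rewrite t2E !mulr_gt0// exprn_gt0.
have c10 : 0 <= c1.
  rewrite addr_ge0// mulr_ge0 ?mulr_ge0 ?addr_ge0// ?mulr_ge0 ?exprn_ge0// ltW//.
have w0 : 0 <= w by move: t1_small; rewrite /w; lra.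
have lrt0 : 0 < l * r * t1 by rewrite mulr_gt0.
have w1 : w <= 20^-1 by rewrite /w; lra.
have [y0 e0] := maxy_attained att z.1.
set G := gradx F z.1 y0.
have hG v := @maxy_upper z.1 y0 v e0.
have hGD := gradx_deviation z.2 e0; rewrite -/G in hGD.
have hPL := primal_PL e0; rewrite -/G in hPL.
have := primal_step a c10 w0 hG.
set lhs1 := mean _ => h1.
apply: le_trans (_ : lhs1 - minimax F + c1 * (1 + th) * nsq (z.2 - a.2)
   + t1 * l / (2 * r) * gap z <= _).
  rewrite lerD2r; apply: le_trans (mean_le (fun i => dual_step_gap a z _)) _.
  rewrite -[X in _ - X + _](mean_cst n0) -[X in _ <= _ + X](mean_cst n0).
  rewrite -[- mean _]mulN1r -meanZ /lhs1 -!meanD; apply: mean_le => i; lra.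
set D := gradx F z.1 z.2 in h1 hGD *.
set S := (1 + w) * (l * r) + w * (l / 2) + c1 in h1.
have hS : S <= 11 / 10 * (l * r) + c1.
  have : w * (l / 2) <= 20^-1 * (l / 2) by rewrite ler_wpM2r ?divr_ge0// ltW.
  have : w * (l * r) <= 20^-1 * (l * r) by rewrite ler_wpM2r// ltW.
  have : l <= l * r by rewrite -{1}[l]mulr1 ler_pM2l.
  rewrite /S; lra.
have hd0 := anchor_dist_ge0 a z.
have hSd : S * t1 ^+ 2 * (2 * l ^+ 2 * anchor_dist a z)
   <= (11 / 10 * (l * r) + c1) * t1 ^+ 2 * (2 * l ^+ 2) * anchor_dist a z.
  rewrite mulrA; apply: ler_wpM2r; first exact: hd0.
  apply: ler_wpM2r; first by rewrite mulr_ge0 ?sqr_ge0.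
  by apply: ler_wpM2r; first exact: sqr_ge0.
(* The squared x-gradients from curvature and Young's inequality fit in the reserve [100^-1] of
   [gradient_pairing_le]. *)
have hD : (c1 * (t1 ^+ 2 / th) + S * t1 ^+ 2) * nsq D <= t1 * (100^-1 * nsq D).
  rewrite [leRHS]mulrA; apply: ler_wpM2r; first exact: nsq_ge0.
  have : S * t1 ^+ 2 <= (11 / 10 * (l * r) + c1) * t1 ^+ 2.
    by rewrite ler_wpM2r ?sqr_ge0.
  have := ler_wpM2l (ltW t1_gt0) drift_small; lra.
have hw : 0 <= w <= 20^-1 by rewrite w0.
have := ler_wpM2l (ltW t1_gt0) (gradient_pairing_le hw hGD).
have := ler_wpM2r hd0 weight_recursion.
have b0 : 0 <= M z.1 - F z.1 z.2 by rewrite subr_ge0 le_maxy.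
have a0 := minimax_le att saddle z.1; rewrite -subr_ge0 in a0.
have hr : t1 * (l / r) <= t1 * (l * r).
  rewrite ler_pM2l// ler_pM2l//; apply: le_trans r1; rewrite invf_le1//.
have hrb := ler_wpM2r b0 hr.
have := ler_wpM2l (ltW t1_gt0) hPL.
have tlr0 : 0 <= t1 * (l / r) by rewrite mulr_ge0 ?divr_ge0// ltW.
have hra := mulr_ge0 tlr0 a0; have hrb0 := mulr_ge0 tlr0 b0.
have -> : t1 * l / (2 * r) * gap z = 2^-1 * (t1 * (l / r) * (M z.1 - minimax F))
   + 40^-1 * (t1 * (l / r) * (M z.1 - F z.1 z.2)).
  by rewrite /gap; field; rewrite gt_eqF.
rewrite /gap; move: h1 hSd hD; rewrite /w /anchor_dist; lra.
Qed.

End Average.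

(** * Stepsizes *)

Section Stepsizes.
Context {R : realType}.
(* [s] is the square root of beta, [N] the epoch length, and [g] the scale of the
   weights put on the squared distance to the anchor. *)
Variables (l r t1 t2 s N g : R).
Hypothesis l0 : 0 < l.
Hypothesis r1 : 1 <= r.
Hypothesis sE : s = 160^-1 ^+ 2.
Hypothesis t1E : t1 = s ^+ 2 / (28 * r ^+ 8 * l).
Hypothesis t2E : t2 = s ^+ 2 / (l * r ^+ 6).
Hypothesis N1 : 1 <= N.
Hypothesis N_ub : N <= 100^-1 * (r ^+ 9 / s ^+ 3).
Hypothesis N_lb : 200^-1 * (r ^+ 9 / s ^+ 3) <= N.
Hypothesis gE : g = l * s / (200 * r ^+ 3).

Let r0 : 0 < r. Proof. exact: lt_le_trans r1. Qed.
Let s0 : 0 < s. Proof. by rewrite sE exprn_gt0 ?invr_gt0. Qed.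
Let N0 : 0 < N. Proof. exact: lt_le_trans N1. Qed.
Let ler_Xr (k : nat) : (r ^+ k)^-1 <= 1.
Proof. by rewrite invf_le1 ?exprn_gt0// exprn_ege1. Qed.
Let r_neq0 : r != 0. Proof. by rewrite gt_eqF. Qed.
Let s_neq0 : s != 0. Proof. by rewrite gt_eqF. Qed.
Let l_neq0 : l != 0. Proof. by rewrite gt_eqF. Qed.
Let N_neq0 : N != 0. Proof. by rewrite gt_eqF. Qed.

Lemma dual_stepsizeE : t2 = 28 * r ^+ 2 * t1.
Proof. by rewrite t1E t2E; field; rewrite r_neq0 l_neq0. Qed.

Lemma primal_stepsize_gt0 : 0 < t1.
Proof. by rewrite t1E divr_gt0 ?mulr_gt0 ?exprn_gt0. Qed.

Lemma weight_gt0 : 0 < g.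
Proof. by rewrite gE divr_gt0 ?mulr_gt0 ?exprn_gt0. Qed.

Let s_le : s <= 1000^-1. Proof. by rewrite sE; lra. Qed.

Let s2_le : s ^+ 2 <= 1000^-1.
Proof.
apply: le_trans s_le; rewrite expr2; apply: ler_piMr (ltW s0) _.
by move: s_le; lra.
Qed.

Let u := l * t2.
Let u_ge0 : 0 <= u. Proof. by rewrite /u t2E !mulr_ge0 ?invr_ge0 ?mulr_ge0 ?exprn_ge0 ?ltW. Qed.
Let uE : u = s ^+ 2 * (r ^+ 6)^-1.
Proof. by rewrite /u t2E; field; rewrite r_neq0 l_neq0. Qed.

Let u_le : u <= 1000^-1.
Proof. by rewrite uE; apply: le_trans s2_le; apply: ler_piMr (ler_Xr 6); exact: sqr_ge0. Qed.

Let t1_le : l * r * t1 <= u.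
Proof.
have -> : l * r * t1 = u * ((28 * r)^-1).
  by rewrite uE t1E; field; rewrite r_neq0 l_neq0.
by apply: ler_piMr => //; rewrite invf_le1; move: r1; lra.
Qed.

(** At the upper bound of [N] all powers of [l], [r] and [s] cancel; this fixes the scale of [g]. *)
Let gNt2 : g * N * t2 <= 100^-1 * 200^-1.
Proof.
apply: le_trans (_ : g * (100^-1 * (r ^+ 9 / s ^+ 3)) * t2 <= _).
  rewrite ler_wpM2r//; first by rewrite t2E divr_ge0 ?mulr_ge0 ?exprn_ge0 ?ltW.
  by apply: ler_wpM2l N_ub; rewrite ltW// weight_gt0.
rewrite gE t2E le_eqVlt; apply/orP; left; apply/eqP; field.
by rewrite r_neq0 l_neq0 s_neq0.
Qed.

(** Up to constants, [l * u ^+ 2] is the weight that variance adds in one step; it must be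
    comparable to the drop [g / N]. *)
Let lu2N : l * u ^+ 2 * N <= 2 * g.
Proof.
apply: le_trans (_ : l * u ^+ 2 * (100^-1 * (r ^+ 9 / s ^+ 3)) <= _).
  by apply: ler_wpM2l N_ub; rewrite mulr_ge0 ?sqr_ge0 ?(ltW l0).
rewrite gE uE le_eqVlt; apply/orP; left; apply/eqP; field.
by rewrite r_neq0 s_neq0.
Qed.

Let g_le : g <= l / 100.
Proof.
have -> : g = l * (s / 200) * (r ^+ 3)^-1 by rewrite gE; field; rewrite r_neq0.
apply: le_trans (_ : l * (s / 200) <= _).
  by apply: ler_piMr => //; rewrite mulr_ge0 ?divr_ge0 ?ltW.
apply: ler_wpM2l; first exact: ltW.
by rewrite sE; lra.
Qed.

Let u2N : u ^+ 2 * N <= 1000^-1.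
Proof.
apply: le_trans (_ : u ^+ 2 * (100^-1 * (r ^+ 9 / s ^+ 3)) <= _).
  by apply: ler_wpM2l N_ub; exact: sqr_ge0.
have -> : u ^+ 2 * (100^-1 * (r ^+ 9 / s ^+ 3)) = 100^-1 * s * (r ^+ 3)^-1.
  by rewrite uE; field; rewrite r_neq0 s_neq0.
apply: le_trans (_ : 100^-1 * s <= _); last by move: s_le s0; lra.
by apply: ler_piMr (ler_Xr 3); rewrite mulr_ge0 ?ltW.
Qed.

(** At the lower bound of [N] the product is [(56 * 200)^-1 / s], which [s = 160^-1 ^+ 2] makes at
    least 2. *)
Lemma epoch_length_large : 2 <= t1 * l / (2 * r) * N.
Proof.
apply: le_trans (_ : t1 * l / (2 * r) * (200^-1 * (r ^+ 9 / s ^+ 3)) <= _).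
  have -> : t1 * l / (2 * r) * (200^-1 * (r ^+ 9 / s ^+ 3)) = (56 * 200)^-1 / s.
    by rewrite t1E; field; rewrite r_neq0 s_neq0 l_neq0.
  by rewrite ler_pdivlMr// sE; lra.
by apply: ler_wpM2l N_lb; rewrite divr_ge0 ?mulr_ge0 ?ltW ?primal_stepsize_gt0.
Qed.

Variables c c' : R.
Hypothesis c'_ge0 : 0 <= c'.
Hypothesis cE : c = c' + g / N.
Hypothesis c_le : c <= 2 * g.
(** Of order [N^-1], so that the loss [c1 * th] is a fraction of [g / N]. *)
Let th := (16 * N)^-1.
Let c1 := c' + (20^-1 * l / 2 + c') * t2 ^+ 2 * (2 * l ^+ 2).

Lemma primal_stepsize_small : 266 / 5 * (l * r * t1) <= 1.
Proof. move: t1_le u_le; lra. Qed.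

Let h := g / N.
Let h0 : 0 < h. Proof. by rewrite divr_gt0 ?weight_gt0. Qed.
Let c'_le : c' <= 2 * g. Proof. by move: h0 c_le; rewrite cE -/h; lra. Qed.
Let h_le : h <= g.
Proof. by rewrite ler_pdivrMr// ler_peMr// ltW// weight_gt0. Qed.
Let lu2_le : l * u ^+ 2 <= 2 * h.
Proof. by rewrite /h mulrA ler_pdivlMr. Qed.

Let t2_ge0 : 0 <= t2.
Proof. by rewrite t2E divr_ge0 ?mulr_ge0 ?exprn_ge0 ?ltW. Qed.

Lemma dual_stepsize_small : l * t2 / 2 + 20 * c' * (t2 / th + t2) <= 20^-1.
Proof.
have -> : t2 / th + t2 = (16 * N + 1) * t2 by rewrite /th invrK; ring.
have h1 : 20 * c' * ((16 * N + 1) * t2) <= 20 * (2 * g) * (17 * N * t2).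
  apply: ler_pM.
  - exact: mulr_ge0.
  - by apply: mulr_ge0 t2_ge0; move: N1; lra.
  - exact: ler_wpM2l c'_le.
  - by apply: (ler_wpM2r t2_ge0); move: N1; lra.
have := u_le; rewrite /u => h2; move: gNt2; lra.
Qed.

Let c1_le : c1 <= c' + 8^-1 * h.
Proof.
have -> : c1 = c' + (20^-1 * (l * u ^+ 2) + 2 * (c' * u ^+ 2)).
  by rewrite /c1 /u; field.
have : c' * u ^+ 2 <= 2 * g * u ^+ 2 by apply: ler_wpM2r c'_le; exact: sqr_ge0.
have : g * u ^+ 2 <= 1000^-1 * h.
  rewrite /h [leRHS]mulrA ler_pdivlMr// -mulrA [leRHS]mulrC.
  by apply: ler_wpM2l u2N; exact/ltW/weight_gt0.
move: lu2_le h0; lra.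
Qed.

Let c1_ge0 : 0 <= c1.
Proof.
apply: addr_ge0 => //; apply: mulr_ge0; last by rewrite mulr_ge0 ?sqr_ge0.
apply: mulr_ge0 (sqr_ge0 _); apply: addr_ge0 => //.
by move: l0; lra.
Qed.

Lemma drift_coefficient_small :
  11 / 10 * (l * r) * t1 + c1 * (t1 + t1 / th) <= 100^-1.
Proof.
have -> : t1 + t1 / th = (16 * N + 1) * t1 by rewrite /th invrK; ring.
have t10 := primal_stepsize_gt0.
have h1 : c1 * ((16 * N + 1) * t1) <= 3 * g * (17 * N * t2).
  apply: ler_pM.
  - exact: c1_ge0.
  - by apply: mulr_ge0 (ltW t10); move: N1; lra.
  - by move: c1_le h_le c'_le h0 weight_gt0; lra.
  - apply: (ler_pM _ (ltW t10)); [by move: N1; lra|by move: N1; lra|].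
    rewrite dual_stepsizeE ler_peMl ?ltW//.
    have : 1 <= r ^+ 2 by rewrite exprn_ege1.
    lra.
move: gNt2 t1_le u_le; lra.
Qed.

(** The drop [h = g / N] is the budget: the variance of the y-update costs at most [h / 8], Young's
    factor [3 / 16 * h] and the x-update [h / 2]. *)
Lemma weight_decrease :
  c1 * (1 + th) + (11 / 10 * (l * r) + c1) * t1 ^+ 2 * (2 * l ^+ 2) <= c.
Proof.
have t10 := primal_stepsize_gt0.
have c13 : c1 <= 3 * g by move: c1_le h_le c'_le h0 weight_gt0; lra.
have h1 : c1 * th <= 3 / 16 * h.
  rewrite /th /h; apply: le_trans (_ : 3 * g * (16 * N)^-1 <= _).
    by apply: ler_wpM2r c13; rewrite invr_ge0 mulr_ge0 ?ltW.
  by rewrite le_eqVlt; apply/orP; left; apply/eqP; field.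
have lr : l <= l * r by rewrite ler_peMr// ltW.
have h2 : (11 / 10 * (l * r) + c1) * t1 ^+ 2 * (2 * l ^+ 2) <= 2^-1 * h.
  apply: le_trans (_ : 2 * (l * r) * t1 ^+ 2 * (2 * l ^+ 2) <= _).
    apply: ler_wpM2r; first by rewrite mulr_ge0 ?exprn_ge0 ?ltW.
    apply: ler_wpM2r; first exact: sqr_ge0.
    by move: c13 g_le lr l0; lra.
  have -> : 2 * (l * r) * t1 ^+ 2 * (2 * l ^+ 2)
      = l * u ^+ 2 * (196^-1 * (r ^+ 3)^-1).
    by rewrite uE t1E; field; rewrite r_neq0 l_neq0.
  apply: le_trans (_ : l * u ^+ 2 * 196^-1 <= _).
    apply: ler_wpM2l; first by rewrite mulr_ge0 ?sqr_ge0 ?ltW.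
    by apply: ler_piMr; [rewrite invr_ge0|exact: ler_Xr].
  move: lu2_le h0; lra.
move: c1_le h0; rewrite cE -/h; lra.
Qed.

End Stepsizes.

(** * Expectation over an epoch *)

Section EpochDraws.
Variable N : nat.

(** With [T = 1] the inner-loop label is always 0. *)
Definition inner_draws (k m : nat) : seq draw :=
  [seq inl (inl (k, 0, j)) | j <- iota 0 m]
  ++ [seq inl (inr (k, 0, j)) | j <- iota 0 m].

Fixpoint past_draws (k : nat) : seq draw :=
  if k is k'.+1 then inr k' :: inner_draws k' N ++ past_draws k' else [::].

Definition draw_epoch (c : draw) : nat :=
  match c with
  | inl (inl (k, _, _)) => k
  | inl (inr (k, _, _)) => k
  | inr k => k
  end.

Lemma mem_inner_draws k m c : c \in inner_draws k m ->
  exists2 j, (j < m)%N & c = inl (inl (k, 0, j)) \/ c = inl (inr (k, 0, j)).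
Proof.
rewrite mem_cat => /orP[] /mapP[j]; rewrite mem_iota /= add0n => jm ->.
  by exists j => //; left.
by exists j => //; right.
Qed.

Lemma mem_past_draws k c : c \in past_draws k -> (draw_epoch c < k)%N.
Proof.
elim: k => // k IH; rewrite inE mem_cat => /or3P[/eqP->//||/IH/ltnW//].
by move=> /mem_inner_draws[j _ [->|->]].
Qed.

Lemma sub_past_draws k : {subset inner_draws k N ++ past_draws k <= @performed 1 N}.
Proof.
move=> c; rewrite mem_cat => /orP[].
  by move=> /mem_inner_draws[j jN [->|->]].
elim: k => // k IH; rewrite inE mem_cat => /or3P[/eqP->//||/IH//].
by move=> /mem_inner_draws[j jN [->|->]].
Qed.

Lemma sub_inner_draws k m m' : (m <= m')%N ->
  {subset inner_draws k m ++ past_draws k <= inner_draws k m' ++ past_draws k}.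
Proof.
move=> mm' c; rewrite !mem_cat => /orP[|->]; last by rewrite orbT.
move=> /orP[] /mapP[j]; rewrite mem_iota /= add0n => jm ->.
  by rewrite map_f// mem_iota add0n (leq_trans jm).
by rewrite orbC [X in _ || X]orbC map_f ?orbT// mem_iota add0n (leq_trans jm).
Qed.

Lemma fresh_first k j :
  inl (inl (k, 0, j)) \notin inner_draws k j ++ past_draws k.
Proof.
rewrite mem_cat; apply/negP => /orP[/mem_inner_draws|/mem_past_draws/=].
  by move=> [j' j'j [[e]|//]]; rewrite e ltnn in j'j.
by rewrite ltnn.
Qed.

(** The second index is averaged first, so the first index of the same step counts as past. *)
Lemma fresh_second k j :
  inl (inr (k, 0, j)) \notin
    inl (inl (k, 0, j)) :: inner_draws k j ++ past_draws k.
Proof.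
rewrite inE mem_cat; apply/negP => /or3P[//|/mem_inner_draws|/mem_past_draws/=].
  by move=> [j' j'j [//|[e]]]; rewrite e ltnn in j'j.
by rewrite ltnn.
Qed.

Lemma fresh_output k :
  (inr k : draw) \notin inner_draws k N ++ past_draws k.
Proof.
rewrite mem_cat; apply/negP => /orP[/mem_inner_draws|/mem_past_draws/=].
  by move=> [j' _ [//|//]].
by rewrite ltnn.
Qed.
End EpochDraws.

Section Epoch.
Context {R : realType} {d : measure_display} {Omega : measurableType d}.
Variable P : probability Omega R.
Context {d1 d2 n N : nat}.
Variables (f : 'I_n -> 'rV[R]_d1 -> 'rV[R]_d2 -> R) (t1 t2 : R).
Variables (i1 i2 : nat -> nat -> nat -> Omega -> 'I_n).
Variable out : nat -> Omega -> 'I_1 * 'I_N.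
Variable z0 : 'rV[R]_d1 * 'rV[R]_d2.
Local Notation point := ('rV[R]_d1 * 'rV[R]_d2)%type.
Hypothesis sampling : vr_agda_sampling P i1 i2 out.

Local Notation X := (draw_value i1 i2 out).
Local Notation z := (vr_agda f t1 t2 z0 i1 i2 out).

Definition epoch_inner (k j : nat) (w : Omega) : point :=
  inner_iterate f t1 t2 (z k w) (fun j => i1 k 0 j w) (fun j => i2 k 0 j w) j.

(** With [T = 1] the selected loop is the only one, and its anchor is the start of the epoch. *)
Lemma vr_agda_epoch k w : z k.+1 w = epoch_inner k (out k w).2 w.
Proof. by rewrite /= /epoch_iterate (ord1 (out k w).1). Qed.

Lemma epoch_inner_determined k : determined X (past_draws N k) (z k) ->
  forall j, (j <= N)%N ->
  determined X (inner_draws k j ++ past_draws N k) (epoch_inner k j).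
Proof.
move=> dz; elim=> [_|j IH jN].
  by apply: determined_sub dz => c cp; rewrite mem_cat cp orbT.
move=> w w' e.
have e' : epoch_inner k j w = epoch_inner k j w'.
  apply: IH (ltnW jN) _ _ _ => c cs; apply: e; exact: sub_inner_draws cs.
have ez : z k w = z k w' by apply: dz => c cp; apply: e; rewrite mem_cat cp orbT.
have jj : j \in iota 0 j.+1 by rewrite mem_iota add0n ltnSn.
have e1 : i1 k 0 j w = i1 k 0 j w'.
  apply: (e (inl (inl (k, 0, j)))); rewrite !mem_cat.
  by rewrite (map_f (fun j : nat => (inl (inl (k, 0, j)) : draw)) jj).
have e2 : i2 k 0 j w = i2 k 0 j w'.
  apply: (e (inl (inr (k, 0, j)))); rewrite !mem_cat.
  by rewrite (map_f (fun j : nat => (inl (inr (k, 0, j)) : draw)) jj) orbT.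
rewrite /epoch_inner /= -/(epoch_inner k j w) -/(epoch_inner k j w').
by rewrite e' ez e1 e2.
Qed.

Lemma vr_agda_determined k : determined X (past_draws N k) (z k).
Proof.
elim: k => [|k IH]; first by move=> w w' _.
move=> w w' e; rewrite !vr_agda_epoch.
have -> : out k w = out k w' by apply: (e (inr k)); rewrite inE eqxx.
apply: epoch_inner_determined IH _ (ltnW (ltn_ord _)) _ _ _ => c cs.
apply: e; rewrite inE; apply/orP; right.
exact: sub_inner_draws (ltnW (ltn_ord _)) _ cs.
Qed.

(** The expectation argument is carried out for abstract [gap], [dist], [c] and [eta] subject to a
    one-step inequality; the concrete ones are supplied in [potential_halves]. *)
Variables (gap : point -> R) (dist : point -> point -> R) (c : nat -> R).
Variable eta : R.
Hypothesis gap_ge0 : forall z, 0 <= gap z.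
Hypothesis dist_ge0 : forall a z, 0 <= dist a z.
Hypothesis dist0 : forall a, dist a a = 0.
Hypothesis c_ge0 : forall j, (j <= N)%N -> 0 <= c j.
Hypothesis eta_ge0 : 0 <= eta.
Hypothesis eta_N : 2 <= eta * N%:R.
Hypothesis step_gap : forall j a z, (j < N)%N ->
  mean (fun i => mean (fun k => gap (vr_step f t1 t2 a i k z)
                        + c j.+1 * dist a (vr_step f t1 t2 a i k z)))
  + eta * gap z <= gap z + c j * dist a z.

Let lyap k j w : R := gap (epoch_inner k j w) + c j * dist (z k w) (epoch_inner k j w).

(** Given the past, the expectation of [lyap k j.+1] is a double average over two fresh indices,
    which [step_gap] bounds pointwise. *)
Lemma integral_inner_step k j : (j < N)%N ->
  (\int[P]_w (lyap k j.+1 w)%:E + \int[P]_w (eta * gap (epoch_inner k j w))%:E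
   <= \int[P]_w (lyap k j w)%:E)%E.
Proof.
move=> jN; have [Xrv Xunif Xind] := sampling.
pose s := inner_draws k j ++ past_draws N k.
have sP : {subset s <= @performed 1 N}.
  move=> c' cs; apply: (@sub_past_draws N k).
  exact: sub_inner_draws (ltnW jN) _ cs.
have dz : determined X s (z k).
  apply: (determined_sub _ (vr_agda_determined (k := k))) => c' cp.
  by rewrite mem_cat cp orbT.
have dI : determined X s (epoch_inner k j).
  by apply: (epoch_inner_determined _ (ltnW jN)); exact: vr_agda_determined.
(* The anchor and the current iterate are hidden behind an opaque [A], of which only the dependence
   on [s] and these identities remain. *)
have [A [dA lyapS lyapE innerE]] : exists A : Omega -> point * point,
    [/\ determined X s A,
        forall w, lyap k j.+1 w = gap (vr_step f t1 t2 (A w).1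
            (i1 k 0 j w) (i2 k 0 j w) (A w).2)
          + c j.+1 * dist (A w).1 (vr_step f t1 t2 (A w).1
            (i1 k 0 j w) (i2 k 0 j w) (A w).2),
        forall w, lyap k j w = gap (A w).2 + c j * dist (A w).1 (A w).2
      & forall w, gap (epoch_inner k j w) = gap (A w).2].
  by exists (fun w => (z k w, epoch_inner k j w)); split => //; exact: determined_comp2.
have step0 := step_gap _ _ jN.
have [L [L0 LE]] : exists L : 'I_n -> 'I_n -> point * point -> R,
    (forall e1 e2 ap, 0 <= L e1 e2 ap) /\
    (forall e1 e2 ap, gap (vr_step f t1 t2 ap.1 e1 e2 ap.2)
       + c j.+1 * dist ap.1 (vr_step f t1 t2 ap.1 e1 e2 ap.2) = L e1 e2 ap).
  exists (fun e1 e2 ap => gap (vr_step f t1 t2 ap.1 e1 e2 ap.2)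
       + c j.+1 * dist ap.1 (vr_step f t1 t2 ap.1 e1 e2 ap.2)); split=> // e1 e2 ap.
  by apply: addr_ge0; [exact: gap_ge0|apply: mulr_ge0; [exact: c_ge0|exact: dist_ge0]].
have step1 ap : mean (fun e1 => mean (fun e2 => L e1 e2 ap)) + eta * gap ap.2
    <= gap ap.2 + c j * dist ap.1 ap.2.
  move: (step0 ap.1 ap.2); under eq_fun do under eq_fun do rewrite LE.
  exact.
under eq_integral do rewrite lyapS LE.
under [X in (_ + X <= _)%E]eq_integral do rewrite innerE.
under [leRHS]eq_integral do rewrite lyapE.
move=> {lyapS lyapE innerE step0 dz dI LE}.
pose c1 : draw := inl (inl (k, 0, j)).
pose c2 : draw := inl (inr (k, 0, j)).
have c1P : c1 \in @performed 1 N by rewrite unfold_in /= jN.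
have c2P : c2 \in @performed 1 N by rewrite unfold_in /= jN.
pose L1 e1 ap := mean (fun e2 => L e1 e2 ap).
pose L2 ap := mean (fun e1 => L1 e1 ap).
have L1_ge0 e1 ap : 0 <= L1 e1 ap by exact: mean_ge0.
have L2_ge0 ap : 0 <= L2 ap by exact: mean_ge0.
have -> : (\int[P]_w (L (i1 k 0 j w) (i2 k 0 j w) (A w))%:E =
    \int[P]_w (L2 (A w))%:E)%E.
  transitivity (\int[P]_w (L1 (i1 k 0 j w) (A w))%:E)%E.
    have := @integral_fresh_draw _ _ _ P _ _ _ X Xrv Xind Xunif c2 (c1 :: s)
      (fun e2 w => L (i1 k 0 j w) e2 (A w)).
    rewrite card_ord; apply.
    - by move=> c'; rewrite inE => /orP[/eqP->|/sP].
    - exact: c2P.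
    - exact: fresh_second.
    - move=> e; apply: (determined_comp2 (fun e1 ap => L e1 e ap)).
        by move=> w w' h; apply: (h c1); rewrite inE eqxx.
      by apply: determined_sub dA => c' cs; rewrite inE cs orbT.
    - by move=> e w; exact: L0.
  have := @integral_fresh_draw _ _ _ P _ _ _ X Xrv Xind Xunif c1 s
      (fun e1 w => L1 e1 (A w)).
  rewrite card_ord; apply.
  - exact: sP.
  - exact: c1P.
  - exact: fresh_first.
  - by move=> e; apply: (determined_comp (L1 e)).
  - by move=> e w; exact: L1_ge0.
have mdet (h : point * point -> R) : (forall ap, 0 <= h ap) ->
    measurable_fun setT (fun w => (h (A w))%:E).
  move=> h0; apply/measurable_EFinP; apply: (measurable_determined Xrv sP) => //.
  exact: determined_comp.
have g0 ap : 0 <= eta * gap (ap : point * point).2 by apply: mulr_ge0.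
have l0 ap : 0 <= gap (ap : point * point).2 + c j * dist ap.1 ap.2.
  by apply: addr_ge0; rewrite ?mulr_ge0 ?c_ge0// ltnW.
rewrite -ge0_integralD//; first last.
- exact: (mdet (fun ap => eta * gap ap.2)).
- by move=> w _; rewrite lee_fin.
- exact: mdet.
- by move=> w _; rewrite lee_fin.
apply: ge0_le_integral => //.
- by move=> w _; rewrite -EFinD lee_fin addr_ge0.
- apply: emeasurable_funD; first exact: mdet.
  exact: (mdet (fun ap => eta * gap ap.2)).
- exact: (mdet (fun ap => gap ap.2 + c j * dist ap.1 ap.2)).
- by move=> w _; rewrite -EFinD lee_fin; exact: step1.
Qed.

(** Telescoping, started by [dist0]. The decrease stays on the left because the integrals are
    extended reals whose finiteness is not established. *)
Lemma integral_inner_sum k m : (m <= N)%N ->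
  (\int[P]_w (lyap k m w)%:E
     + \sum_(j < m) \int[P]_w (eta * gap (epoch_inner k j w))%:E
   <= \int[P]_w (gap (z k w))%:E)%E.
Proof.
elim: m => [_|m IH mN].
  rewrite big_ord0 adde0 le_eqVlt; apply/orP; left; apply/eqP.
  by apply: eq_integral => w _; rewrite /lyap dist0 mulr0 addr0.
apply: le_trans (IH (ltnW mN)); rewrite big_ord_recr /= addeCA addeC.
by rewrite leeD2r// integral_inner_step.
Qed.

(** The uniform output makes the new expectation an average over the inner iterates, and
    [N%:R^-1 <= 2^-1 * eta] compares it with the telescoped sum. *)
Lemma integral_epoch k :
  (\int[P]_w (gap (z k.+1 w))%:E <= (2^-1)%:E * \int[P]_w (gap (z k w))%:E)%E.
Proof.
have [Xrv Xunif Xind] := sampling.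
pose s := inner_draws k N ++ past_draws N k.
have sP : {subset s <= @performed 1 N} by exact: sub_past_draws.
have dI j : (j <= N)%N -> determined X s (epoch_inner k j).
  move=> jN; apply: (determined_sub _ (epoch_inner_determined _ jN)).
    exact: sub_inner_draws.
  exact: vr_agda_determined.
have dg j : (j <= N)%N -> determined X s (fun w => gap (epoch_inner k j w)).
  by move=> jN; apply: (determined_comp gap); exact: dI.
have -> : (\int[P]_w (gap (z k.+1 w))%:E =
    \sum_(j < N) \int[P]_w (N%:R^-1 * gap (epoch_inner k j w))%:E)%E.
  under eq_integral do rewrite vr_agda_epoch.
  have := @integral_fresh_draw _ _ _ P _ _ _ X Xrv Xind Xunif (inr k) s
      (fun e w => gap (epoch_inner k e.2 w)).
  rewrite card_prod !card_ord mul1n => -> //.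
  - rewrite -ge0_integral_sum//.
    + apply: eq_integral => w _; rewrite sumEFin mulr_sumr; congr (_%:E).
      rewrite -(pair_bigA _ (fun (a : 'I_1) (b : 'I_N) =>
         N%:R^-1 * gap (epoch_inner k b w))) /= big_ord_recl big_ord0 addr0.
      by [].
    + move=> j; apply/measurable_EFinP; apply: (measurable_determined Xrv sP).
        by apply: (determined_comp (fun p => N%:R^-1 * gap p)); apply/dI/ltnW.
      by move=> w; rewrite mulr_ge0.
    + by move=> j w _; rewrite lee_fin mulr_ge0.
  - exact: fresh_output.
  - by move=> e; apply: dg; rewrite ltnW.
have Nn0 : (0 < N)%N by rewrite lt0n; apply: contraTneq eta_N => ->; rewrite mulr0 -ltNge.
have hN : N%:R^-1 <= 2^-1 * eta.
  rewrite -(@ler_pM2r _ N%:R) ?ltr0n// mulVf ?pnatr_eq0 -?lt0n//.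
  move: eta_N; lra.
apply: le_trans (_ : (2^-1)%:E *
    \sum_(j < N) \int[P]_w (eta * gap (epoch_inner k j w))%:E <= _)%E; last first.
  apply: lee_wpmul2l; first by rewrite lee_fin.
  apply: le_trans (integral_inner_sum k (leqnn N)).
  rewrite leeDr// integral_ge0// => w _.
  by rewrite lee_fin addr_ge0// mulr_ge0// c_ge0.
have mg (a : R) (j : 'I_N) : 0 <= a ->
    measurable_fun setT (fun w => (a * gap (epoch_inner k j w))%:E).
  move=> a0; apply/measurable_EFinP; apply: (measurable_determined Xrv sP).
    by apply: (determined_comp (fun p => a * gap p)); apply/dI/ltnW.
  by move=> w; rewrite mulr_ge0.
rewrite ge0_sume_distrr; last first.
  by move=> j _; apply: integral_ge0 => w _; rewrite lee_fin mulr_ge0.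
apply: lee_sum => j _; rewrite -ge0_integralZl//.
- apply: ge0_le_integral => //.
  + by move=> w _; rewrite lee_fin mulr_ge0.
  + exact: mg.
  + under eq_fun do rewrite -EFinM mulrA.
    by apply: mg; rewrite mulr_ge0.
  + by move=> w _; rewrite -EFinM lee_fin mulrA ler_wpM2r.
- exact: mg.
- by move=> w _; rewrite lee_fin mulr_ge0.
Qed.
End Epoch.

(** * Size of the epoch length and number of epochs *)

(** With beta equal to [s ^+ 2] the real powers are [s] and [(s ^+ 3)^-1]. As [q] lies in [0, 1],
    the value before truncation is between [Q / 150] and [Q / 100], and [600 <= Q] absorbs the unit
    lost by truncation. *)
Lemma truncn_epoch_length (R : realType) (r s : R) : 1 <= r -> s = 160^-1 ^+ 2 ->
  let N := (Num.truncn (50^-1 * (s ^+ 2) `^ (- (3 / 2)) * r ^+ 9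
             * (2 + 4 * (s ^+ 2) `^ (1 / 2) * r ^- 3)^-1))%:R : R in
  [/\ 1 <= N, N <= 100^-1 * (r ^+ 9 / s ^+ 3)
    & 200^-1 * (r ^+ 9 / s ^+ 3) <= N].
Proof.
move=> r1 sE.
have r0 : 0 < r by apply: lt_le_trans r1.
have s0 : 0 < s by rewrite sE exprn_gt0 ?invr_gt0.
have half : (s ^+ 2) `^ (1 / 2) = s.
  rewrite -powR_mulrn ?ltW// -powRrM mul1r mulfV ?pnatr_eq0//.
  by rewrite powRr1 ?ltW.
have mthree : (s ^+ 2) `^ (- (3 / 2)) = (s ^+ 3)^-1.
  rewrite -powR_mulrn ?ltW// -powRrM mulrN powRN.
  have -> : 2 * (3 / 2) = 3%:R :> R by field.
  by rewrite powR_mulrn ?ltW.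
rewrite half mthree.
set Q := r ^+ 9 / s ^+ 3; set q := 4 * s * r ^- 3.
have q0 : 0 <= q by rewrite !mulr_ge0 ?invr_ge0 ?exprn_ge0 ?ltW.
have q1 : q <= 1.
  apply: le_trans (_ : 4 * s <= _); last by rewrite sE; lra.
  apply: ler_piMr; first by rewrite mulr_ge0 ?ltW.
  by rewrite invf_le1 ?exprn_gt0// exprn_ege1.
have Q0 : 0 < Q by rewrite divr_gt0 ?exprn_gt0.
have Q600 : 600 <= Q.
  have s600 : 600 * s <= 1 by rewrite sE; lra.
  rewrite /Q ler_pdivlMr ?exprn_gt0//.
  apply: le_trans (_ : 1 <= _); last by rewrite exprn_ege1.
  have s1 : s <= 1 by move: s600; lra.
  apply: le_trans s600; apply: ler_wpM2l => //.
  by rewrite exprS; apply: ler_piMr (ltW s0) _; exact: exprn_ile1 (ltW s0) s1.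
have q2 : 0 < 2 + q by rewrite ltr_wpDr.
have -> : 50^-1 * (s ^+ 3)^-1 * r ^+ 9 * (2 + q)^-1 = 50^-1 * Q * (2 + q)^-1.
  by rewrite /Q; field; rewrite !gt_eqF.
set Y := 50^-1 * Q * (2 + q)^-1.
have Yhi : Y <= 100^-1 * Q.
  rewrite /Y ler_pdivrMr//; have := mulr_ge0 (ltW Q0) q0; lra.
have Ylo : 150^-1 * Q <= Y.
  rewrite /Y ler_pdivlMr//.
  have : Q * q <= Q by rewrite ler_piMr// ltW.
  lra.
have Y0 : 0 <= Y by move: Q0 Ylo; lra.
have hi : (Num.truncn Y)%:R <= Y by rewrite truncn_le.
have lo : Y < (Num.truncn Y)%:R + 1 by rewrite natr1; exact: truncnS_gt.
split; move: Yhi Ylo hi lo Q600; lra.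
Qed.

(** From [2^-1 <= expR (- 2^-1)], [2 * L <= k] gives [2^-1 ^+ k <= expR (- L)]; the witness is at
    most [2 * L + 1 <= 3 * L] because [1 <= L]. *)
Lemma halving_time (R : realType) (p eps : R) : 0 <= p -> 0 < eps ->
  exists K : nat, [/\ (0 < K)%N,
    forall k, (K <= k)%N -> 2^-1 ^+ k * p <= eps
    & K%:R <= 3 * Num.max 1 (ln (p / eps))].
Proof.
move=> p0 eps0; set L := Num.max 1 (ln (p / eps)).
have L1 : 1 <= L by rewrite le_max lexx.
have hi : (Num.truncn (2 * L))%:R <= 2 * L by rewrite truncn_le; lra.
have lo : 2 * L < (Num.truncn (2 * L)).+1%:R by exact: truncnS_gt.
exists (Num.truncn (2 * L)).+1; split=> //; last first.
  by rewrite -natr1; move: hi L1; lra.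
move=> k Kk; have {lo}Lk : 2 * L <= k%:R.
  by apply: le_trans (ltW lo) _; rewrite ler_nat.
(* For [p = 0] the logarithm is a default value, so this case is separate. *)
have [->|pn0] := eqVneq p 0; first by rewrite mulr0 ltW.
have {pn0}p0 : 0 < p by rewrite lt_def pn0.
rewrite -ler_pdivlMr// -[eps / p]invf_div.
have h : 2^-1 <= expR (- 2^-1) :> R by apply: le_trans (expR_ge1Dx _); lra.
apply: le_trans (_ : expR (- 2^-1) ^+ k <= _).
  by apply: lerXn2r; rewrite ?nnegrE ?expR_ge0.
rewrite -expRM_natl mulrN expRN; apply: le_trans (_ : (expR (ln (p / eps)))^-1 <= _).
  rewrite lef_pV2 ?posrE ?expR_gt0// ler_expR.
  have : ln (p / eps) <= L by rewrite le_max lexx orbT.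
  by move: Lk; lra.
rewrite lnK ?posrE ?divr_gt0//.
Qed.

(** * Contraction of the potential along the epochs *)

Section Contraction.
Context {R : realType} {d : measure_display} {Omega : measurableType d}.
Variable P : probability Omega R.
Context {d1 d2 n N : nat}.
Variables (f : 'I_n -> 'rV[R]_d1 -> 'rV[R]_d2 -> R) (t1 t2 : R).
Variables (i1 i2 : nat -> nat -> nat -> Omega -> 'I_n).
Variable out : nat -> Omega -> 'I_1 * 'I_N.
Variable z0 : 'rV[R]_d1 * 'rV[R]_d2.
Hypothesis sampling : vr_agda_sampling P i1 i2 out.
Local Notation F := (average f).
Local Notation z := (vr_agda f t1 t2 z0 i1 i2 out).
Hypothesis saddle : has_saddle_point F.
Hypothesis att : partial_maxima_attained F.

Lemma measurable_vr_agda (h : 'rV[R]_d1 * 'rV[R]_d2 -> R) k :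
  (forall p, 0 <= h p) -> measurable_fun setT (fun w => (h (z k w))%:E).
Proof.
move=> h0; have [Xrv _ _] := sampling.
apply/measurable_EFinP.
apply: (measurable_determined (s := past_draws N k) Xrv) => [c ck||w].
- by apply: (@sub_past_draws N k); rewrite mem_cat ck orbT.
- by apply: (determined_comp h); exact: vr_agda_determined.
- exact: h0.
Qed.

Lemma potentialE k : potential P F z k = (\int[P]_w (gap f (z k w))%:E)%E.
Proof.
rewrite /potential /primal_gap /dual_gap unlock.
have a0 p : 0 <= maxy F (p : _ * 'rV[R]_d2).1 - minimax F.
  by rewrite subr_ge0 minimax_le.
have b0 p : 0 <= maxy F p.1 - F p.1 p.2 by rewrite subr_ge0 le_maxy.
have mb := measurable_vr_agda k b0.
rewrite -ge0_integralZl//; last by move=> w _; rewrite lee_fin b0.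
rewrite -ge0_integralD//.
- by move=> w _; rewrite lee_fin a0.
- exact: (measurable_vr_agda k a0).
- by move=> w _; rewrite -EFinM lee_fin mulr_ge0.
- exact: (@measurable_vr_agda (fun p => 20^-1 * (maxy F p.1 - F p.1 p.2)) k
    (fun p => mulr_ge0 _ (b0 p))).
Qed.

Lemma potential0 : potential P F z 0 = (gap f z0)%:E.
Proof.
rewrite potentialE /=.
by have := expectation_cst P (gap f z0); rewrite unlock.
Qed.

Variables (l mu1 mu2 r s : R).
Hypothesis n0 : (0 < n)%N.
Hypothesis l0 : 0 < l.
Hypothesis cdf : forall i, continuously_differentiable (f i).
Hypothesis lipf : forall i, lipschitz_gradients l (f i).
Hypothesis atm : partial_minima_attained F.
Hypothesis r1 : 1 <= r.
Hypothesis mu1r : l / r <= mu1.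
Hypothesis mu2r : l / r <= mu2.
Hypothesis PL : two_sided_PL mu1 mu2 F.
Hypothesis sE : s = 160^-1 ^+ 2.
Hypothesis t1E : t1 = s ^+ 2 / (28 * r ^+ 8 * l).
Hypothesis t2E : t2 = s ^+ 2 / (l * r ^+ 6).
Hypothesis N1 : 1 <= N%:R :> R.
Hypothesis N_ub : N%:R <= 100^-1 * (r ^+ 9 / s ^+ 3).
Hypothesis N_lb : 200^-1 * (r ^+ 9 / s ^+ 3) <= N%:R.

Lemma potential_halves k :
  (potential P F z k.+1 <= (2^-1)%:E * potential P F z k)%E.
Proof.
have r0 : 0 < r by apply: lt_le_trans r1.
have N0 : 0 < N%:R :> R by apply: lt_le_trans N1.
pose g := l * s / (200 * r ^+ 3).
have gE : g = l * s / (200 * r ^+ 3) by [].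
have g0 := weight_gt0 l0 r1 sE gE.
have t10 := primal_stepsize_gt0 l0 r1 sE t1E.
(* The weights decrease linearly from [2 * g] to [g] over the inner loop, by [g / N] per step. *)
pose c (j : nat) := g * (2 - j%:R / N%:R).
have c_g j : (j <= N)%N -> g <= c j.
  move=> jN; apply: ler_peMr (ltW g0) _.
  have : j%:R / N%:R <= 1 :> R by rewrite ler_pdivrMr// mul1r ler_nat.
  lra.
have c_2g j : c j <= 2 * g.
  rewrite /c [leRHS]mulrC; apply: (ler_wpM2l (ltW g0)).
  have : 0 <= j%:R / N%:R :> R by rewrite divr_ge0.
  lra.
have cS j : c j = c j.+1 + g / N%:R.
  by rewrite /c -natr1; field; rewrite gt_eqF.
rewrite !potentialE.
apply: (integral_epoch z0 sampling (dist := anchor_dist) (c := c)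
  (eta := t1 * l / (2 * r))).
- exact: gap_ge0.
- exact: anchor_dist_ge0.
- by move=> a; rewrite /anchor_dist !subrr /nsq /dot !big1 ?addr0// => j _;
    rewrite mxE mul0r.
- by move=> j jN; apply: le_trans (c_g j jN); exact: ltW.
- by rewrite divr_ge0 ?mulr_ge0 ?ltW.
- exact: epoch_length_large sE t1E N_lb.
- move=> j a p jN.
  have c'0 : 0 <= c j.+1 by apply: le_trans (c_g _ jN); exact: ltW.
  apply: (vr_step_gap n0 l0 cdf lipf saddle atm att r1 mu1r mu2r PL t10
    (th := (16 * N%:R)^-1)) => //.
  + by rewrite invr_gt0 mulr_gt0.
  + exact: (dual_stepsizeE l0 r1 t1E t2E).
  + exact: (primal_stepsize_small l0 r1 sE t1E t2E).
  + exact: (dual_stepsize_small l0 r1 sE t2E N1 N_ub gE c'0 (cS j) (c_2g j)).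
  + exact: (drift_coefficient_small l0 r1 sE t1E t2E N1 N_ub gE c'0 (cS j) (c_2g j)).
  + exact: (weight_decrease l0 r1 sE t1E t2E N1 N_ub gE (cS j) (c_2g j)).
Qed.

Lemma potential_geometric k :
  (potential P F z k <= (2^-1 ^+ k * gap f z0)%:E)%E.
Proof.
elim: k => [|k IH]; first by rewrite potential0 expr0 mul1r.
apply: le_trans (potential_halves k) _.
rewrite exprS -mulrA EFinM; apply: lee_wpmul2l IH.
by rewrite lee_fin invr_ge0.
Qed.
End Contraction.

(** * Choice of the absolute constants and complexity count *)

Unset Implicit Arguments.

Theorem theorem4p1 (R : realType) :
  exists alpha beta C : R,
    [/\ 0 < alpha, 0 < beta, 0 < C &
     forall (n d1 d2 : nat) (f : 'I_n -> 'rV[R]_d1 -> 'rV[R]_d2 -> R)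
            (l mu1 mu2 : R),
     (0 < n)%N ->
     (forall i, continuously_differentiable (f i)) ->
     (forall i, lipschitz_gradients l (f i)) ->
     has_saddle_point (average f) ->
     partial_minima_attained (average f) ->
     partial_maxima_attained (average f) ->
     0 < mu1 -> 0 < mu2 -> mu1 <= l -> mu2 <= l ->
     two_sided_PL mu1 mu2 (average f) ->
     let kappa := l / Num.min mu1 mu2 in
     let tau1 := beta / (28 * kappa ^+ 8 * l) in
     let tau2 := beta / (l * kappa ^+ 6) in
     let N := Num.truncn (alpha * beta `^ (- (3 / 2)) * kappa ^+ 9
                          * (2 + 4 * beta `^ (1 / 2) * kappa ^- 3)^-1) in
     let T := 1%N in
     (0 < N)%N /\
     forall (d : measure_display) (Omega : measurableType d)
            (P : probability Omega R)
            (i1 i2 : nat -> nat -> nat -> Omega -> 'I_n)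
            (out : nat -> Omega -> 'I_T * 'I_N)
            (z0 : 'rV[R]_d1 * 'rV[R]_d2),
     vr_agda_sampling P i1 i2 out ->
     let Pk := potential P (average f) (vr_agda f tau1 tau2 z0 i1 i2 out) in
     (forall k : nat, (Pk k.+1 <= (2^-1)%:E * Pk k)%E) /\
     (forall eps : R, 0 < eps ->
        exists K : nat,
          [/\ (0 < K)%N,
              forall k : nat, (K <= k)%N -> (Pk k <= eps%:E)%E
            & (vr_agda_cost n T N K)%:R
                <= C * (n%:R + kappa ^+ 9)
                   * Num.max 1 (ln (fine (Pk 0%N) / eps))])].
Proof.
(* [s] is the square root of beta, so beta is [160^-1 ^+ 4]; alpha is [50^-1]. *)
pose s : R := 160^-1 ^+ 2; have sE : s = 160^-1 ^+ 2 by [].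
have s0 : 0 < s by rewrite exprn_gt0 ?invr_gt0.
clearbody s.
(* [B] bounds the cost [2 * n + 4 * N] of one epoch relative to [n + kappa ^+ 9], by the upper bound
   on [N]; the factor 3 in the witness [3 * B] comes from [halving_time]. *)
pose B := 2 + 4 * (100^-1 / s ^+ 3); have B2 : 2 <= B.
  by rewrite lerDl mulr_ge0 ?divr_ge0 ?exprn_ge0 ?ltW.
exists 50^-1, (s ^+ 2), (3 * B); split.
- by rewrite invr_gt0.
- exact: exprn_gt0.
- by move: B2; lra.
move=> n d1 d2 f l mu1 mu2 n0 cdf lipf saddle atm att mu10 mu20 mu1l mu2l PL.
move=> kappa tau1 tau2 N T.
have l0 : 0 < l by apply: lt_le_trans mu1l.
have mu0 : 0 < Num.min mu1 mu2 by rewrite lt_min mu10.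
have r1 : 1 <= kappa by rewrite ler_pdivlMr// mul1r ge_min mu1l.
have muE : l / kappa = Num.min mu1 mu2.
  by rewrite /kappa; field; rewrite !gt_eqF.
have mu1r : l / kappa <= mu1 by rewrite muE ge_min lexx.
have mu2r : l / kappa <= mu2 by rewrite muE ge_min lexx orbT.
have [N1 N_ub N_lb] := truncn_epoch_length r1 sE.
rewrite -/N in N1 N_ub N_lb.
split; first by rewrite -(ler_nat R).
move=> d Omega P i1 i2 out z0 sampling Pk.
have halves := potential_halves z0 sampling saddle att n0 l0 cdf lipf atm r1
  mu1r mu2r PL sE (erefl tau1) (erefl tau2) N1 N_ub N_lb.
split=> // eps eps0.
have geometric := potential_geometric z0 sampling saddle att n0 l0 cdf lipf atm
  r1 mu1r mu2r PL sE (erefl tau1) (erefl tau2) N1 N_ub N_lb.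
have [K [K0 hK costK]] := halving_time (gap_ge0 saddle att z0) eps0.
exists K; split=> //.
  by move=> k /hK hk; apply: le_trans (geometric k) _; rewrite lee_fin.
rewrite /Pk (potential0 _ _ z0 sampling saddle att) /=.
set L := Num.max 1 _ in costK *.
rewrite /vr_agda_cost mul1n natrM natrD !natrM.
have hcost : 2 * n%:R + 4 * N%:R <= B * (n%:R + kappa ^+ 9).
  have : 2 * n%:R <= B * n%:R by apply: ler_wpM2r.
  have k9 : 0 <= 2 * kappa ^+ 9 by rewrite mulr_ge0// exprn_ge0// (le_trans _ r1).
  have -> : B * (n%:R + kappa ^+ 9) = B * n%:R + 2 * kappa ^+ 9
      + 4 * (100^-1 * (kappa ^+ 9 / s ^+ 3)).
    by rewrite /B; ring.
  move: N_ub k9; lra.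
apply: le_trans (_ : 3 * L * (B * (n%:R + kappa ^+ 9)) <= _).
  by apply: ler_pM => //; rewrite addr_ge0// mulr_ge0.
by rewrite le_eqVlt; apply/orP; left; apply/eqP; ring.
Qed.
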